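(* The two-agent exploration strategy for tadpole graphs described below (the AMP strategy with random choice of paths once the intersection is found) has, for every outcome of its random choices, cost at most $2.5\cdot opt(G,s,2)$ on every tadpole graph $G$ and start node $s$, in the time model (and hence also in the energy model).
   Context: Multi-agent online graph exploration: an undirected connected graph $G=(V,E)$ with positive edge lengths $l(e)$ and distinctly labelled nodes is initially unknown. $k$ agents start at a node $s$; initially they know $s$, its incident edges (with lengths) and its neighbours. Whenever an agent visits a node $v$ for the first time, all edges incident to $v$ (with lengths) and the neighbours of $v$ are revealed. Agents share all information instantly, have unlimited computation, move at unit speed (traversing $e$ takes time $l(e)$), and may wait. The exploration is finished when every node has been visited and all agents are back at $s$. Time model: cost is the finishing time; energy model: cost is the maximum total distance travelled by any single agent (never larger than the finishing time). $opt(G,s,k)$ is the minimum cost of an exploration by $k$ agents with full prior knowledge of $G$. A tadpole graph consists of a cycle together with a path (the tail, at least one edge) attached to one cycle node (the intersection $v_i$, of degree 3); the other tail end $v_t$ has degree 1. AMP rule: each agent keeps the total distance it has travelled; an agent moving along a path traverses its next edge only if its travelled distance plus that edge's length is smaller than that of the other agent (ties: the other agent moves), so that only one agent moves at a time. Strategy: if $s=v_t$ (degree 1), both agents go to $v_i$, explore the cycle by the AMP rule in opposite directions and return to $s$. If $s=v_i$ (degree 3), two of the three outgoing edges are chosen at random and each agent follows one of them by the AMP rule; when an agent has finished its path (or the cycle is fully explored) it continues with the remaining unexplored part, and at the end all agents return to $s$ along shortest paths. If $s$ has degree 2, the agents start in the two directions by the AMP rule; when an agent reaches $v_i$ it chooses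 one of the outgoing unexplored paths at random, and the remaining unexplored part is explored by whichever agent becomes available, after which all agents return to $s$ along shortest paths.
   Formalization: After an agent finishes a path and takes over another, the AMP rule compares its distance from s along the new path, not its total distance travelled: with the latter the bound fails (cycle 0.99, 0.01, 2.995, tail 1, s = v_i: time 6.985, opt 2). Costs still count every walk and wait. *)

(* Defs.v *)
From mathcomp Require Import all_boot all_order all_algebra.
From mathcomp Require Import classical_sets reals.
Set Implicit Arguments.
Unset Strict Implicit.
Unset Printing Implicit Defensive.
Import Order.TTheory GRing.Theory Num.Theory.
Local Open Scope ring_scope.

(* Simple graphs; [len x y] is meaningful only when [edge x y]. *)
Record wgraph (R : realType) (V : finType) := WGraph {
  edge : rel V;
  len : V -> V -> R;
  edge_sym : symmetric edge;
  edge_irr : irreflexive edge;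
  edge_conn : forall x y, connect edge x y;
  len_sym : forall x y, edge x y -> len x y = len y x;
  len_gt0 : forall x y, edge x y -> 0 < len x y
}.

(* Tadpole: [vi :: c] lists the cycle in cyclic order, starting with the
   intersection [vi]; [t] lists the tail from the neighbour of [vi] to the
   free end. *)
Definition tadpole_edges (V : finType) (vi : V) (c t : seq V) : seq (V * V) :=
  zip (vi :: c) (rot 1 (vi :: c)) ++ zip (vi :: t) t.

Definition tadpole (R : realType) (V : finType) (G : wgraph R V) : Prop :=
  exists (vi : V) (c t : seq V),
    [/\ (2 <= size c)%N, (1 <= size t)%N,
        uniq (vi :: c ++ t), (forall x, x \in vi :: c ++ t) &
        forall x y, edge G x y =
          ((x, y) \in tadpole_edges vi c t) || ((y, x) \in tadpole_edges vi c t)].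

(* What one agent does over time, starting at time 0. *)
Inductive action (R : realType) (V : finType) :=
| Move of V
| Wait of R.
Arguments Move {R V} _.
Arguments Wait {R V} _.

Notation plan R V := (seq (action R V)).

Fixpoint plan_valid (R : realType) (V : finType) (G : wgraph R V)
    (x : V) (p : plan R V) : bool :=
  match p with
  | [::] => true
  | Move y :: p' => edge G x y && plan_valid G y p'
  | Wait d :: p' => (0 <= d) && plan_valid G x p'
  end.

Fixpoint plan_nodes (R : realType) (V : finType) (x : V) (p : plan R V) : seq V :=
  match p with
  | [::] => [:: x]
  | Move y :: p' => x :: plan_nodes y p'
  | Wait _ :: p' => plan_nodes x p'
  end.

Fixpoint plan_end (R : realType) (V : finType) (x : V) (p : plan R V) : V :=
  match p with
  | [::] => x
  | Move y :: p' => plan_end y p'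
  | Wait _ :: p' => plan_end x p'
  end.

Fixpoint plan_time (R : realType) (V : finType) (G : wgraph R V)
    (x : V) (p : plan R V) : R :=
  match p with
  | [::] => 0
  | Move y :: p' => len G x y + plan_time G y p'
  | Wait d :: p' => d + plan_time G x p'
  end.

Fixpoint plan_dist (R : realType) (V : finType) (G : wgraph R V)
    (x : V) (p : plan R V) : R :=
  match p with
  | [::] => 0
  | Move y :: p' => len G x y + plan_dist G y p'
  | Wait _ :: p' => plan_dist G x p'
  end.

Definition exploration (R : realType) (V : finType) (G : wgraph R V) (s : V)
    (k : nat) (P : 'I_k -> plan R V) : Prop :=
  (forall i, plan_valid G s (P i) /\ plan_end s (P i) = s) /\
  (forall v, exists i, v \in plan_nodes s (P i)).

Definition time_cost (R : realType) (V : finType) (G : wgraph R V) (s : V)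
    (k : nat) (P : 'I_k -> plan R V) : R :=
  \big[Num.max/0]_(i < k) plan_time G s (P i).

Definition energy_cost (R : realType) (V : finType) (G : wgraph R V) (s : V)
    (k : nat) (P : 'I_k -> plan R V) : R :=
  \big[Num.max/0]_(i < k) plan_dist G s (P i).

(* Full prior knowledge: the plans are arbitrary functions of the graph. *)
Definition opt_time (R : realType) (V : finType) (G : wgraph R V) (s : V)
    (k : nat) : R :=
  inf [set c | exists2 P : 'I_k -> plan R V,
                 exploration G s P & c = time_cost G s P]%classic.

Definition opt_energy (R : realType) (V : finType) (G : wgraph R V) (s : V)
    (k : nat) : R :=
  inf [set c | exists2 P : 'I_k -> plan R V,
                 exploration G s P & c = energy_cost G s P]%classic.

(* A walk from [x] is [x :: p]. *)
Definition walk_len (R : realType) (V : finType) (G : wgraph R V)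
    (x : V) (p : seq V) : R :=
  \sum_(d <- pairmap (len G) x p) d.

Definition walk_in (R : realType) (V : finType) (G : wgraph R V) (D : {set V})
    (x y : V) (p : seq V) : bool :=
  [&& path (edge G) x p, all [in D] (x :: p) & last x p == y].

Definition shortest (R : realType) (V : finType) (G : wgraph R V) (D : {set V})
    (x y : V) (p : seq V) : Prop :=
  walk_in G D x y p /\
  forall q, walk_in G D x y q -> walk_len G x p <= walk_len G x q.

(* The two-agent strategy.  It is a transition system whose nondeterminism is
   that of the random choices, of ties in the AMP rule and of ties between
   shortest paths; it consults only edges with a visited endpoint, which are
   exactly the revealed ones.
   [trav i] is the quantity compared by the AMP rule: the distance agent [i]
   has travelled from [s] along the path it is following.  It differs from the
   length of everything the agent has walked only once the agent has finished
   one path and taken over another, since the walk back is not part of the new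
   path; that walk is of course charged to the costs, which are computed from
   [log].
   [goal i] is the next node on the path of agent [i]. *)
Record state (R : realType) (V : finType) := State {
  pos : 'I_2 -> V;
  trav : 'I_2 -> R;
  goal : 'I_2 -> option V;
  visited : {set V};
  log : 'I_2 -> plan R V
}.

(* An agent has finished its path when the latter leads to no unvisited node,
   possibly because the other agent has visited the goal in the meantime. *)
Definition heading (R : realType) (V : finType) (st : state R V) (i : 'I_2)
    : option V :=
  if goal st i is Some v then
    if v \in visited st then None else Some v
  else None.

Definition fresh (R : realType) (V : finType) (G : wgraph R V) (D : {set V})
    (v : V) : {set V} :=
  [set w | edge G v w & w \notin D].

(* Both agents leave [v]: by distinct unexplored edges if there are two. *)
Definition split_goals (R : realType) (V : finType) (G : wgraph R V)
    (D : {set V}) (v : V) (w : 'I_2 -> V) : Prop :=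
  (forall i, w i \in fresh G D v) /\
  ((1 < #|fresh G D v|)%N -> w ord0 != w ord_max).

Definition next_goal (R : realType) (V : finType) (G : wgraph R V)
    (D : {set V}) (v : V) (g : option V) : Prop :=
  if g is Some w then w \in fresh G D v else fresh G D v = finset.set0.

(* The edge from [u] to [w] leads to an unvisited node and is not the one that
   agent [j] is about to traverse. *)
Definition unclaimed (R : realType) (V : finType) (G : wgraph R V)
    (st : state R V) (j : 'I_2) (u w : V) : Prop :=
  [/\ u \in visited st, w \in fresh G (visited st) u &
      ~ (pos st j = u /\ heading st j = Some w)].

Definition together (R : realType) (V : finType) (st : state R V) : Prop :=
  [/\ pos st ord0 = pos st ord_max, heading st ord0 = heading st ord_max &
      heading st ord0 <> None].

(* Agent [i], whose next node is [v], may move while agent [j] waits.  A tie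
   may be resolved in favour of either agent.  If [j] has finished its path, it
   first takes over the unexplored part that is left, if any. *)
Definition amp_turn (R : realType) (V : finType) (G : wgraph R V)
    (st : state R V) (i j : 'I_2) (v : V) : Prop :=
  if heading st j is Some w then
    trav st i + len G (pos st i) v <= trav st j + len G (pos st j) w
  else forall u w, ~ unclaimed G st i u w.

Definition explored (R : realType) (V : finType) (G : wgraph R V)
    (st : state R V) : Prop :=
  forall u, u \in visited st -> fresh G (visited st) u = finset.set0.

Definition finished (R : realType) (V : finType) (G : wgraph R V) (s : V)
    (st : state R V) : Prop :=
  explored G st /\ forall i, pos st i = s.

(* If [s] has degree 1, the agents start together and separate at the first
   node of degree 3; if it has degree 2 or 3, they separate at [s]. *)
Inductive initial (R : realType) (V : finType) (G : wgraph R V) (s : V) :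
    state R V -> Prop :=
| Initial w of split_goals G [set s] s w :
    initial G s
      (State (fun=> s) (fun=> 0) (fun i => Some (w i)) [set s] (fun=> [::])).

Inductive step (R : realType) (V : finType) (G : wgraph R V) (s : V)
    (st : state R V) : state R V -> Prop :=
| StepTogether v w of
    together st & heading st ord0 = Some v &
    split_goals G (v |: visited st) v w :
    step G s st
      (State (fun=> v)
             (fun i => trav st i + len G (pos st i) v)
             (fun i => Some (w i))
             (v |: visited st)
             (fun i => rcons (log st i) (Move v)))
| StepAmp i j v g of
    i != j & ~ together st & heading st i = Some v & amp_turn G st i j v &
    next_goal G (v |: visited st) v g :
    step G s st
      (State [eta pos st with i |-> v]
             [eta trav st with i |-> trav st i + len G (pos st i) v]
             [eta goal st with i |-> g]
             (v |: visited st)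
             [eta log st with
                i |-> rcons (log st i) (Move v),
                j |-> rcons (log st j) (Wait (len G (pos st i) v))])
(* Agent [i] has finished its path; it takes over the unexplored path that
   leaves [u] towards [w], while [j] waits.  [q] is the way from [s] to [u],
   hence the beginning of the new path of [i]. *)
| StepTakeOver i j u w p q of
    i != j & heading st i = None & unclaimed G st j u w &
    shortest G (visited st) (pos st i) u p & shortest G (visited st) s u q :
    step G s st
      (State [eta pos st with i |-> u]
             [eta trav st with i |-> walk_len G s q]
             [eta goal st with i |-> Some w]
             (visited st)
             [eta log st with
                i |-> log st i ++ map Move p,
                j |-> rcons (log st j) (Wait (walk_len G (pos st i) p))])
| StepReturn p of
    explored G st & ~ finished G s st &
    (forall i, shortest G (visited st) (pos st i) s (p i)) :
    step G s st
      (State (fun=> s)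
             (fun i => trav st i + walk_len G (pos st i) (p i))
             (fun=> None)
             (visited st)
             (fun i => log st i ++ map Move (p i))).

(* Every run from [st] terminates, only in finished states, and its two plans
   then satisfy [Q]. *)
Inductive every_run (R : realType) (V : finType) (G : wgraph R V) (s : V)
    (Q : ('I_2 -> plan R V) -> Prop) (st : state R V) : Prop :=
| RunFinished of finished G s st & Q (log st)
| RunStep of ~ finished G s st & (exists st', step G s st st') &
    (forall st', step G s st st' -> every_run G s Q st').

Definition amp_guarantees (R : realType) (V : finType) (G : wgraph R V) (s : V)
    (Q : ('I_2 -> plan R V) -> Prop) : Prop :=
  (exists st, initial G s st) /\
  forall st, initial G s st -> every_run G s Q st.

(* Main.v *)
(* Let M be the largest distance from s.  A closed walk from s through v has
   length at least 2 d(s, v), so every exploration costs at least 2 M, even in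
   the energy model.  As the final return of both agents takes time at most M,
   it suffices that everything before lasts at most 4 M.  Once the agents have
   separated they move one at a time, so this duration is the sum of the
   lengths they have walked.

   The AMP rule makes the agents run Dijkstra's algorithm: the edge traversed
   next is the shortest continuation of the explored part of the graph, hence
   some unvisited node is at least that far from s.  So the distance of an agent
   from s along the path it follows never exceeds M, which accounts for 2 M.
   Walking back from a finished path in order to take over another one accounts
   for 2 M more: either it is a walk along the tail and back, or it comes after
   the end of the cycle, when only the tail, whose end is within M, is left.

   Distances from s are bounded below by means of 1-Lipschitz functions that
   vanish at s ("potentials"). *)
Require Import Defs.
From mathcomp Require Import all_boot all_order all_algebra.
From mathcomp Require Import classical_sets reals.
From mathcomp Require Import boolp.
From mathcomp Require Import lra zify.
Set Implicit Arguments.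
Unset Strict Implicit.
Unset Printing Implicit Defensive.
Import Order.TTheory GRing.Theory Num.Theory.
Local Open Scope ring_scope.

Lemma ord2_or (i j k : 'I_2) : i != j -> k = i \/ k = j.
Proof.
by case: i j k => [[|[|i]] ?] [[|[|j]] ?] [[|[|k]] ?] //= _;
  (left; exact: val_inj) || (right; exact: val_inj).
Qed.

Lemma ord2_pair (i j i' j' : 'I_2) : i != j -> i' != j' ->
  (i' = i /\ j' = j) \/ (i' = j /\ j' = i).
Proof.
move=> ij; case: (ord2_or i' ij) => ->; case: (ord2_or j' ij) => ->;
  by rewrite ?eqxx //; tauto.
Qed.

(** * Walks, distances and plans *)

Section Walks.
Context (R : realType) (V : finType) (G : wgraph R V).
Implicit Types (x y u v w a b : V) (p q r t : seq V) (D : {set V}) (h g : V -> R).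

Lemma walk_len0 x : walk_len G x [::] = 0.
Proof. by rewrite /walk_len big_nil. Qed.

Lemma walk_len_cons x y p : walk_len G x (y :: p) = len G x y + walk_len G y p.
Proof. by rewrite /walk_len /= big_cons. Qed.

Lemma walk_len_cat x p q :
  walk_len G x (p ++ q) = walk_len G x p + walk_len G (last x p) q.
Proof.
elim: p x => [|y p IH] x /=; first by rewrite walk_len0 add0r.
by rewrite !walk_len_cons IH addrA.
Qed.

Lemma walk_len_ge0 x p : path (edge G) x p -> 0 <= walk_len G x p.
Proof.
elim: p x => [|y p IH] x /=; first by rewrite walk_len0.
by case/andP=> /len_gt0 /ltW lxy /IH; rewrite walk_len_cons; exact: addr_ge0.
Qed.

Definition potential h := forall x y, edge G x y -> h y <= h x + len G x y.

Lemma potential_walk h x p : potential h -> path (edge G) x p ->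
  h (last x p) <= h x + walk_len G x p.
Proof.
move=> hh; elim: p x => [|y p IH] x /=; first by rewrite walk_len0 addr0.
by case/andP=> /hh hxy /IH; rewrite walk_len_cons; lra.
Qed.

Lemma walk_suffix x y p : path (edge G) x p -> y \in x :: p ->
  exists q, [/\ path (edge G) y q, last y q = last x p, {subset q <= p},
    walk_len G y q <= walk_len G x p & uniq (x :: p) -> uniq (y :: q)].
Proof.
elim: p x => [|z p IH] x; rewrite inE; case: eqVneq => [->|_] //=.
- by exists [::].
- by move=> xp _; exists (z :: p); split.
case/andP=> exz zp yp; have [q [yq lq sq wq uq]] := IH z zp yp.
exists q; split=> //; first by move=> w /sq; rewrite inE orbC => ->.
  by rewrite walk_len_cons; have := len_gt0 exz; lra.
by case/andP=> _ /uq.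
Qed.

Lemma walk_simplify x p : path (edge G) x p ->
  exists q, [/\ path (edge G) x q, last x q = last x p, {subset q <= p},
    walk_len G x q <= walk_len G x p & uniq (x :: q)].
Proof.
elim: p x => [|z p IH] x /=; first by exists [::].
case/andP=> exz /IH[q [zq lq sq wq uq]].
have lxz := len_gt0 exz.
have szq : {subset z :: q <= z :: p}.
  by move=> w; rewrite !inE => /orP[->//|/sq ->]; rewrite orbT.
have [xq|xNq] := boolP (x \in z :: q); last first.
  exists (z :: q); rewrite !walk_len_cons /= exz xNq; split=> //; lra.
have [q' [xq' lq' sq' wq' uq']] := walk_suffix zq xq.
exists q'; split; rewrite ?lq' ?walk_len_cons //; last exact: uq'.
  by move=> w /sq' wq0; apply: szq; rewrite inE wq0 orbT.
lra.
Qed.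

Lemma walk_inP D x y p : reflect
  [/\ path (edge G) x p, x \in D, {subset p <= D} & last x p = y]
  (walk_in G D x y p).
Proof.
apply: (iffP and3P) => [[-> /andP[-> /allP sp] /eqP->]|[-> xD sp /eqP->]] //.
by split=> //; rewrite /= xD; apply/allP.
Qed.

Lemma shortest_exists D x y p : walk_in G D x y p -> exists q, shortest G D x y q.
Proof.
have simp q : walk_in G D x y q -> exists2 b : {bseq #|V| of V},
    walk_in G D x y b & walk_len G x b <= walk_len G x q.
  case/walk_inP=> xq xD sq lq.
  have [q' [xq' lq' sq' wq' /= /andP[_ uq']]] := walk_simplify xq.
  have bq' : (size q' <= #|V|)%N by rewrite -(card_uniqP uq') max_card.
  exists (Bseq bq') => //=; apply/walk_inP; split=> //; last by rewrite lq'.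
  by move=> w /sq' /sq.
move=> /simp[b0 wb0 _].
have [b wb minb] := arg_minP (P := fun b : {bseq #|V| of V} => walk_in G D x y b)
  (fun b : {bseq #|V| of V} => walk_len G x b) wb0.
by exists b; split=> // q /simp[b' /minb le_bb' le_b'q]; exact: le_trans le_b'q.
Qed.

Definition reach D x y (d : R) := exists2 p, walk_in G D x y p & walk_len G x p = d.

Lemma reach_refl D x : x \in D -> reach D x x 0.
Proof. by move=> xD; exists [::]; rewrite ?walk_len0 //; apply/walk_inP. Qed.

Lemma reach_trans D x y z d e : reach D x y d -> reach D y z e -> reach D x z (d + e).
Proof.
move=> [p /walk_inP[xp xD sp <-] <-] [q /walk_inP[yq _ sq <-] <-].
exists (p ++ q); last by rewrite walk_len_cat.
apply/walk_inP; rewrite cat_path xp yq last_cat; split=> // w.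
by rewrite mem_cat => /orP[/sp|/sq].
Qed.

Lemma reach_edge D x y : edge G x y -> x \in D -> y \in D -> reach D x y (len G x y).
Proof.
move=> exy xD yD; exists [:: y]; last by rewrite walk_len_cons walk_len0 addr0.
by apply/walk_inP; split=> //=; [rewrite exy|move=> w; rewrite inE => /eqP->].
Qed.

Lemma reach_sub (D D' : {set V}) x y d : D \subset D' -> reach D x y d -> reach D' x y d.
Proof.
move=> /fintype.subsetP sD [p /walk_inP[xp xD sp lp] <-]; exists p => //.
by apply/walk_inP; split=> //; [exact: sD|move=> w /sp /sD].
Qed.

Lemma reach_sym D x y d : reach D x y d -> reach D y x d.
Proof.
case=> p; elim: p x d => [|z p IH] x d /walk_inP[/= xp xD sp lp] <-.
  by rewrite walk_len0 -lp; exact: reach_refl.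
case/andP: xp => exz zp; have zD : z \in D by rewrite sp ?mem_head.
rewrite walk_len_cons addrC; apply: (@reach_trans _ _ z).
  by apply: IH => //; apply/walk_inP; split=> // w wp; rewrite sp // inE wp orbT.
by rewrite len_sym //; apply: reach_edge; rewrite // edge_sym.
Qed.

Lemma reach_mem D x y d : reach D x y d -> x \in D /\ y \in D.
Proof.
case=> p /walk_inP[_ xD sp <-] _; split=> //.
by have := mem_last x p; rewrite inE => /orP[/eqP->|/sp].
Qed.

Lemma shortest_reach D x y p d : shortest G D x y p -> reach D x y d -> walk_len G x p <= d.
Proof. by move=> [_ minp] [q wq <-]; exact: minp. Qed.

Lemma reach_shortest D x y p : shortest G D x y p -> reach D x y (walk_len G x p).
Proof. by case=> wp _; exists p. Qed.

Lemma reach_exists_shortest D x y d : reach D x y d -> exists p, shortest G D x y p.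
Proof. by case=> p /shortest_exists. Qed.

Lemma reachT x y : exists d, reach [set: V] x y d.
Proof.
have /connectP[p xp ->] := edge_conn G x y.
by exists (walk_len G x p), p => //; apply/walk_inP; split=> // w _; rewrite inE.
Qed.

Lemma plan_dist_ge0 x (P : plan R V) : plan_valid G x P -> 0 <= plan_dist G x P.
Proof.
elim: P x => [|[y|d] P IH] x //= /andP[].
  by move=> /len_gt0 ? /IH; lra.
by move=> _ /IH.
Qed.

Lemma potential_plan h x (P : plan R V) v : potential h -> plan_valid G x P ->
  v \in plan_nodes x P -> h v - h x + h v - h (plan_end x P) <= plan_dist G x P.
Proof.
move=> hh.
have end_le y (Q : plan R V) z : plan_valid G y Q -> z = y -> h z - h (plan_end y Q) <= plan_dist G y Q.
  elim: Q y z => [y z _ -> /=|[w|d] Q IH y z /= /andP[]]; first by rewrite subrr.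
    move=> eyw vQ ->; have := IH w w vQ erefl.
    by have := hh w y; rewrite edge_sym -(len_sym eyw) => /(_ eyw); lra.
  by move=> _ /IH; apply.
elim: P x => [|[y|d] P IH] x /=.
- by rewrite inE => _ /eqP->; lra.
- case/andP=> exy vP; rewrite inE => /orP[/eqP->|/IH].
    by have := @end_le x (Move y :: P) x; rewrite /= exy vP => /(_ isT erefl); lra.
  by move=> /(_ vP); have := hh x y exy; lra.
- by case/andP=> _ /IH.
Qed.

Lemma plan_dist_le_time x (P : plan R V) : plan_valid G x P ->
  plan_dist G x P <= plan_time G x P.
Proof.
by elim: P x => [|[y|d] P IH] x //= /andP[e /IH]; lra.
Qed.

Context (s : V).

(* The second property is the only form in which lower bounds on [M] are used. *)
Lemma eccentricity : exists M : R,
  [/\ 0 <= M,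
      forall g, g s = 0 -> potential g -> forall v, g v <= M,
      forall v, exists2 d, reach [set: V] s v d & d <= M &
      forall P : 'I_2 -> plan R V, exploration G s P -> 2 * M <= energy_cost G s P].
Proof.
have /fin_all_exists[f fP] : forall v, exists p, shortest G [set: V] s v p.
  by move=> v; have [d /reach_exists_shortest] := reachT s v.
have fpath v : path (edge G) s (f v) by case: (fP v) => /walk_inP[].
have flast v : last s (f v) = v by case: (fP v) => /walk_inP[].
pose dist v := walk_len G s (f v).
have dist_s : dist s = 0.
  apply/eqP; rewrite eq_le walk_len_ge0 // andbT.
  by apply: shortest_reach (fP s) _; apply: reach_refl.
have pot_dist : potential dist.
  move=> x y exy; apply: shortest_reach (fP y) _.
  by apply: reach_trans (reach_shortest (fP x)) (reach_edge exy _ _).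
exists (\big[Num.max/0]_v dist v).
have le_max v : dist v <= \big[Num.max/0]_v dist v by exact: le_bigmax.
split=> [|g gs pg v|v|P [Pval Pcov]].
- by rewrite -{1}dist_s.
- have := potential_walk pg (fpath v); rewrite flast gs add0r => gv; exact: le_trans gv (le_max v).
- by exists (dist v) => //; exact: reach_shortest.
- rewrite mulrC -ler_pdivlMr // bigmax_le //.
    rewrite divr_ge0 //; apply: le_trans (plan_dist_ge0 (proj1 (Pval ord0))) _.
    exact: (le_bigmax _ (fun i => plan_dist G s (P i))).
  move=> v _; have [i vi] := Pcov v; have [vP eP] := Pval i.
  have := potential_plan pot_dist vP vi; rewrite eP dist_s.
  have : plan_dist G s (P i) <= energy_cost G s P.
    exact: (le_bigmax _ (fun i => plan_dist G s (P i))).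
  by rewrite ler_pdivlMr //; lra.
Qed.

End Walks.

(** * Unvisited paths and potentials *)

Section Segments.
Context (R : realType) (V : finType) (G : wgraph R V).
Implicit Types (x y u v w a b : V) (p q r t : seq V) (D : {set V}) (h g : V -> R).

Definition onext r (ob : option V) := if r is w :: _ then Some w else ob.

(* The nodes of [r] form a path attached to the rest of the graph by its first
   node, which is adjacent to [a], and, if [ob = Some b], by its last node,
   which is adjacent to [b]. *)
Fixpoint seg a r (ob : option V) : Prop :=
  if r is w :: r' then
    (forall u, edge G u w = (u == a) || (Some u == onext r' ob)) /\ seg w r' ob
  else True.

Lemma ohead_rev_cons w r : ohead (rev (w :: r)) = Some (last w r).
Proof. by rewrite lastI rev_rcons. Qed.

Lemma ohead_mem r w : ohead r = Some w -> w \in r.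
Proof. by case: r => //= x r [->]; exact: mem_head. Qed.

Lemma seg_cat a r1 w r2 ob : seg a (r1 ++ w :: r2) ob ->
  seg a r1 (Some w) /\ seg (last a r1) (w :: r2) ob.
Proof.
elim: r1 a => [|x r1 IH] a //= [hx /IH[/= s1 s2]]; split=> //; split=> //.
by move=> u; rewrite hx; case: (r1).
Qed.

Lemma seg_rev a r b : seg a r (Some b) -> seg b (rev r) (Some a).
Proof.
have snoc : forall c r' w ob, seg c r' (Some w) ->
    (forall u, edge G u w = (u == last c r') || (Some u == ob)) -> seg c (rcons r' w) ob.
  move=> c r' w ob; elim: r' c => [|x r' IH] c /=; first by move=> _ hw; split.
  by move=> [hx sx] hw; split; [move=> u; rewrite hx; case: (r')|exact: IH].
elim: r a => [|w r IH] a //= [hw /IH sr]; rewrite rev_cons; apply: snoc => // u.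
rewrite hw orbC; congr (_ || _).
by case: (r) => [|x r'] //=; rewrite rev_cons last_rcons.
Qed.

Lemma seg_edge a r ob u w : seg a r ob -> w \in r -> edge G u w ->
  [\/ u \in r, u = a /\ ohead r = Some w | ob = Some u /\ ohead (rev r) = Some w].
Proof.
elim: r a => [//|v r IH] a /= [hv sr]; rewrite inE; case: eqVneq => [-> _|_ /= wr euw].
  rewrite hv => /orP[/eqP->|/eqP]; first by constructor 2.
  case: r {IH sr hv} => [/= ub|x r' [->]]; first by constructor 3.
  by constructor 1; rewrite !inE eqxx orbT.
case: (IH v sr wr euw) => [ur|[-> _]|[-> rw]].
- by constructor 1; rewrite inE ur orbT.
- by constructor 1; rewrite mem_head.
- by constructor 3; split=> //; rewrite rev_cons -rw; case: (rev r) (rw).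
Qed.

Lemma seg_head_edge a v r ob : seg a (v :: r) ob -> edge G a v.
Proof. by case=> ->; rewrite eqxx. Qed.

Lemma seg_next_goal a v r ob D o : seg a (v :: r) ob ->
  a \in D -> (forall x, x \in r -> x \notin D) -> (forall b, ob = Some b -> b \in D) ->
  next_goal G D v o -> o = ohead r.
Proof.
case=> hv _ aD rD bD; case: o => [w|] /=.
  rewrite !inE edge_sym hv => /andP[/orP[/eqP->|/eqP e]]; first by rewrite aD.
  by case: r {hv} rD e => [_ /= /esym/bD ->|x r _ [->]].
case: r hv rD => //= x r hv rD /setP/(_ x); rewrite !inE edge_sym hv eqxx orbT.
by rewrite rD ?mem_head.
Qed.

Context (s : V).

Definition pot r h := h s = 0 /\
  forall x y, edge G x y -> x \notin r -> y \notin r -> h y <= h x + len G x y.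

Lemma eq_pot r r' h : r =i r' -> pot r h -> pot r' h.
Proof. by move=> e [hs hl]; split=> // x y; rewrite -!e; exact: hl. Qed.

Lemma pot_extend a v r h : pot (v :: r) h -> edge G a v -> v != s ->
  (forall u, edge G u v -> u \notin r -> u = a) ->
  pot r [eta h with v |-> h a + len G a v].
Proof.
move=> [hs hl] eav vs only_a; split=> /=; first by rewrite eq_sym (negPf vs).
have av : a == v = false by apply/negP => /eqP e; rewrite e edge_irr in eav.
move=> x y exy xr yr; case: (eqVneq y v) => [yv|nyv]; case: (eqVneq x v) => [xv|nxv].
- by rewrite xv yv edge_irr in exy.
- by subst y; rewrite (only_a x exy xr).
- subst x; rewrite edge_sym in exy; rewrite (only_a y exy yr).
  by have := len_gt0 eav; rewrite -(len_sym eav); lra.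
- by apply: hl; rewrite // inE negb_or ?nxv ?nyv.
Qed.

Lemma pot_extend_tail a t r h : pot (t ++ r) h -> seg a t None ->
  s \notin t -> exists2 h', pot r h' & {in [predC t], h' =1 h}.
Proof.
elim: t a h => [|w t IH] a h /=; first by move=> hh _ _; exists h.
rewrite inE negb_or => hh [hw st] /andP[sw snt].
have eaw : edge G a w by rewrite hw eqxx.
have ws : w != s by rewrite eq_sym.
have only_a u : edge G u w -> u \notin t ++ r -> u = a.
  rewrite hw mem_cat => /orP[/eqP//|/eqP]; case: (t) => //= x t' [->].
  by rewrite mem_head.
have [h' hh' eqh] := IH w _ (pot_extend hh eaw ws only_a) st snt.
exists h' => // x; rewrite inE /= inE negb_or => /andP[/negPf xw xt].
by rewrite eqh ?inE //= xw.
Qed.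

(* Dijkstra's argument: every walk into [r] has length at least [k]. *)
Lemma truncated_potential r h (k : R) : pot r h -> 0 <= k -> s \notin r ->
  (forall u w, u \notin r -> w \in r -> edge G u w -> k <= h u + len G u w) ->
  exists g, [/\ g s = 0, potential G g & forall w, w \in r -> g w = k].
Proof.
move=> [hs hl] k0 sr bd; exists (fun v => if v \in r then k else Num.min (h v) k).
split=> [|x y exy|w ->] //; first by rewrite (negPf sr) hs min_l.
have lxy := len_gt0 exy.
have [xr|xr] := boolP (x \in r); have [yr|yr] := boolP (y \in r).
- by lra.
- by rewrite ge_min; apply/orP; right; lra.
- by have := bd x y xr yr exy; rewrite minElt; case: ifP; lra.
- by have := hl x y exy xr yr; rewrite !minElt; case: ifP; case: ifP; lra.
Qed.

Lemma tail_potential a t g : g s = 0 -> potential G g -> seg a t None ->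
  s \notin t -> uniq (a :: t) -> (forall x, x \in t -> g x = g a) ->
  exists g', [/\ g' s = 0, potential G g' & g' (last a t) = g a + walk_len G a t].
Proof.
elim: t a g => [|w t IH] a g gs pg.
  by exists g; split=> //=; rewrite walk_len0 addr0.
move=> st snt uat gt; have /= eaw := seg_head_edge st.
pose g1 x := if x \in w :: t then g x + len G a w else g x.
have law := len_gt0 eaw.
have g1w : g1 w = g a + len G a w by rewrite /g1 mem_head gt ?mem_head.
have atN : a \notin w :: t by case/andP: uat.
have edge_in x y : edge G x y -> y \in w :: t -> x \notin w :: t -> x = a /\ y = w.
  move=> exy yt xt; case: (seg_edge st yt exy) => [xt'|[-> [->]]|[]] //.
  by rewrite xt' in xt.
have pg1 : potential G g1.
  move=> x y exy; rewrite /g1; have := pg x y exy.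
  have [yt|yt] := boolP (y \in w :: t); have [xt|xt] := boolP (x \in w :: t) => gxy.
  - by lra.
  - by have [ex ey] := edge_in x y exy yt xt; subst x y; rewrite gt ?mem_head //.
  - by lra.
  - by [].
have [||||g' [g's pg' eg']] // := IH w g1 _ pg1 (proj2 st).
- by rewrite /g1 (negPf snt).
- by move: snt; rewrite inE negb_or => /andP[].
- by case/andP: uat.
- by move=> x xt; rewrite g1w /g1 inE xt orbT gt // inE xt orbT.
by exists g'; split=> //; rewrite /= eg' g1w walk_len_cons addrA.
Qed.

End Segments.

(** * Tadpoles *)

Section Tadpoles.
Context (R : realType) (V : finType) (G : wgraph R V).
Implicit Types (x y u v w a b : V) (p q r t l c : seq V).

Definition links a r (ob : option V) := zip (a :: r) (r ++ seq_of_opt ob).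

Lemma links_cons a x r ob : links a (x :: r) ob = (a, x) :: links x r ob.
Proof. by []. Qed.

Lemma mem_links a r ob u w : (u, w) \in links a r ob ->
  u \in a :: r /\ (w \in r \/ ob = Some w).
Proof.
elim: r a => [|x r IH] a; rewrite /links /=.
  by case: ob => [b|//] /=; rewrite !inE xpair_eqE => /andP[/eqP-> /eqP->]; split=> //; right.
rewrite inE xpair_eqE => /orP[/andP[/eqP-> /eqP->]|/IH[ux wr]].
  by rewrite !mem_head; split=> //; left.
rewrite inE ux orbT; split=> //; case: wr => [wr|->]; last by right.
by left; rewrite inE wr orbT.
Qed.

Lemma links_head a r ob u : a \notin r -> ((a, u) \in links a r ob) = (Some u == onext r ob).
Proof.
case: r => [|x r]; rewrite /links /=.
  by case: ob => [b|//] _ /=; rewrite inE xpair_eqE eqxx.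
move=> aN; rewrite inE xpair_eqE eqxx /= orb_idr // => /mem_links[au _].
by rewrite au in aN.
Qed.

Lemma links_last a r b u : b \notin r -> ((u, b) \in links a r (Some b)) = (u == last a r).
Proof.
elim: r a => [|x r IH] a; rewrite /links /=; first by rewrite inE xpair_eqE eqxx andbT.
rewrite !inE negb_or xpair_eqE => /andP[/negPf-> bN].
by rewrite andbF; exact: IH.
Qed.

Lemma seg_links a r ob : uniq (a :: r) -> (forall b, ob = Some b -> b \notin r) ->
  (forall u w, w \in r -> edge G u w = ((u, w) \in links a r ob) || ((w, u) \in links a r ob)) ->
  seg G a r ob.
Proof.
elim: r a => [//|x r IH] a ua bN e; split.
  move=> u; have /= /and3P[aN xN ur] := ua; rewrite e ?mem_head //.
  rewrite links_cons !inE !xpair_eqE eqxx andbT.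
  rewrite links_head //; have [xa|xa] := eqVneq x a; first by rewrite xa mem_head in aN.
  congr (_ || _); rewrite orb_idr // => /mem_links[_ [xr|obx]]; first by rewrite xr in xN.
  by case/negP: (bN x obx); exact: mem_head.
apply: IH; first by case/andP: ua.
  by move=> b /bN; rewrite inE negb_or => /andP[].
have /= /and3P[aN xN ur] := ua.
move=> u w wr; rewrite e; last by rewrite inE wr orbT.
rewrite links_cons !inE !xpair_eqE.
have -> : w == x = false by apply: contraNF xN => /eqP <-.
have -> : w == a = false by apply: contraNF aN => /eqP <-; rewrite inE wr orbT.
by rewrite andbF.
Qed.

Lemma tadpole_segments : tadpole G -> exists vi c t,
  [/\ (1 < size c)%N /\ t <> [::], uniq (vi :: c ++ t), forall x, x \in vi :: c ++ t,
      seg G vi c (Some vi) /\ seg G vi t None &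
      forall u, edge G u vi = [|| u == head vi c, u == last vi c | Some u == ohead t]].
Proof.
move=> [vi [c [t [sc st ut cov e]]]]; exists vi, c, t.
have {}e x y : edge G x y =
    [|| (x, y) \in links vi c (Some vi), (x, y) \in links vi t None,
        (y, x) \in links vi c (Some vi) | (y, x) \in links vi t None].
  have lt : zip (vi :: t) t = links vi t None by rewrite /links cats0.
  by rewrite e /tadpole_edges rot1_cons -cats1 lt !mem_cat -orbA.
have /andP[viN uct] : (vi \notin c ++ t) && uniq (c ++ t) := ut; rewrite cat_uniq in uct.
have /and3P[uc /hasPn dj ut'] := uct.
have [vic vit] : vi \notin c /\ vi \notin t by move: viN; rewrite mem_cat => /norP.
split; [by split=> // t0; rewrite t0 in st|exact: ut|exact: cov| |].
- split; apply: seg_links; rewrite /= ?vic ?vit //.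
  + by move=> b [<-].
  + move=> u w wc; rewrite e.
    have nt z : (z, w) \in links vi t None = false.
      by apply/negP => /mem_links[_ [/dj /negP|]].
    have nt' z : (w, z) \in links vi t None = false.
      apply/negP => /mem_links[+ _]; rewrite inE => /orP[/eqP ew|/dj /negP //].
      by rewrite ew (negPf vic) in wc.
    by rewrite nt nt' orbF.
  + move=> u w wt; rewrite e.
    have nc z : (z, w) \in links vi c (Some vi) = false.
      apply/negP => /mem_links[_ [wc|[ew]]]; first by case/negP: (dj w wt).
      by rewrite -ew (negPf vit) in wt.
    have nc' z : (w, z) \in links vi c (Some vi) = false.
      apply/negP => /mem_links[+ _]; rewrite inE => /orP[/eqP ew|wc]; last by case/negP: (dj w wt).
      by rewrite ew (negPf vit) in wt.
    by rewrite nc nc'.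
- move=> u; rewrite e links_last // !links_head //.
  have -> : (u, vi) \in links vi t None = false.
    by apply/negP => /mem_links[_ [vt|//]]; rewrite vt in vit.
  have -> : onext t None = ohead t by case: (t).
  have -> : onext c (Some vi) = Some (head vi c) by case: (c).
  by rewrite /= orbCA.
Qed.

End Tadpoles.

(** * Invariants of all runs *)

Section Runs.
Context (R : realType) (V : finType) (G : wgraph R V) (s : V).
Implicit Types (st : state R V) (x y u v w a b : V) (p q r t : seq V).
Implicit Types (i j k : 'I_2) (P Q : plan R V).

Lemma plan_valid_cat x P Q :
  plan_valid G x (P ++ Q) = plan_valid G x P && plan_valid G (plan_end x P) Q.
Proof. by elim: P x => [|[y|d] P IH] x //=; rewrite IH andbA. Qed.

Lemma plan_end_cat x P Q : plan_end x (P ++ Q) = plan_end (plan_end x P) Q.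
Proof. by elim: P x => [|[y|d] P IH] x /=. Qed.

Lemma plan_time_cat x P Q :
  plan_time G x (P ++ Q) = plan_time G x P + plan_time G (plan_end x P) Q.
Proof. by elim: P x => [|[y|d] P IH] x /=; rewrite ?add0r // IH addrA. Qed.

Lemma mem_plan_nodes_catl x P Q v :
  v \in plan_nodes x P -> v \in plan_nodes x (P ++ Q).
Proof.
elim: P x => [|[y|d] P IH] x /=.
- rewrite inE => /eqP ->; elim: Q x => [|[y|d] Q IH] x /=; by rewrite ?mem_head.
- by rewrite !inE => /orP[->//|/IH->]; rewrite orbT.
- exact: IH.
Qed.

Lemma mem_plan_end x P : plan_end x P \in plan_nodes x P.
Proof.
by elim: P x => [|[y|d] P IH] x /=; rewrite ?mem_head // inE IH orbT.
Qed.

Lemma plan_valid_moves x p : plan_valid G x (map Move p) = path (edge G) x p.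
Proof. by elim: p x => [|y p IH] x //=; rewrite IH. Qed.

Lemma plan_end_moves x p : plan_end x (map (@Move R V) p) = last x p.
Proof. by elim: p x => [|y p IH] x /=. Qed.

Lemma plan_time_moves x p : plan_time G x (map Move p) = walk_len G x p.
Proof. by elim: p x => [|y p IH] x /=; rewrite ?walk_len0 ?walk_len_cons ?IH. Qed.

Record base st (th : R) : Prop := Base {
  base_valid : forall k, plan_valid G s (log st k);
  base_end : forall k, plan_end s (log st k) = pos st k;
  base_time : forall k, plan_time G s (log st k) = th;
  base_cover : forall v, v \in visited st -> exists k, v \in plan_nodes s (log st k);
  base_pos : forall k, reach G (visited st) s (pos st k) (trav st k);
  base_reach : forall v, v \in visited st -> exists d, reach G (visited st) s v d }.

Lemma base_pos_visited st th k : base st th -> pos st k \in visited st.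
Proof. by move=> /base_pos/(_ k)/reach_mem[]. Qed.

Lemma base_start_visited st th : base st th -> s \in visited st.
Proof. by move=> /base_pos/(_ ord0)/reach_mem[]. Qed.

Definition amp_state st i j v o :=
  State [eta pos st with i |-> v]
        [eta trav st with i |-> trav st i + len G (pos st i) v]
        [eta goal st with i |-> o]
        (v |: visited st)
        [eta log st with
           i |-> rcons (log st i) (Move v),
           j |-> rcons (log st j) (Wait (len G (pos st i) v))].

Definition takeover_state st i j u w p q :=
  State [eta pos st with i |-> u]
        [eta trav st with i |-> walk_len G s q]
        [eta goal st with i |-> Some w]
        (visited st)
        [eta log st with
           i |-> log st i ++ map Move p,
           j |-> rcons (log st j) (Wait (walk_len G (pos st i) p))].

Definition together_state st v (w : 'I_2 -> V) :=
  State (fun=> v)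
        (fun k => trav st k + len G (pos st k) v)
        (fun k => Some (w k))
        (v |: visited st)
        (fun k => rcons (log st k) (Move v)).

Lemma reach_new (D : {set V}) a v d : reach G D s a d -> edge G a v ->
  reach G (v |: D) s v (d + len G a v).
Proof.
move=> sa eav; have [_ aD] := reach_mem sa.
by apply: reach_trans (reach_sub (finset.subsetUr _ _) sa) (reach_edge _ _ _); rewrite ?inE ?aD ?eqxx ?orbT.
Qed.

Lemma base_amp st th i j v o : base st th -> i != j -> edge G (pos st i) v ->
  base (amp_state st i j v o) (th + len G (pos st i) v).
Proof.
case=> bv be bt bc bp br ij ev; have ji : (j == i) = false by rewrite eq_sym (negPf ij).
have lv := ltW (len_gt0 ev); split=> /=.
- move=> k; case: (ord2_or k ij) => ->; rewrite ?ji eqxx -cats1 plan_valid_cat bv //= ?be ?ev ?lv //.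
- by move=> k; case: (ord2_or k ij) => ->; rewrite ?ji eqxx -cats1 plan_end_cat //= be.
- by move=> k; case: (ord2_or k ij) => ->; rewrite ?ji eqxx -cats1 plan_time_cat //= bt ?be addr0.
- move=> x; rewrite in_setU1 => /orP[/eqP->|/bc[k xk]].
    by exists i; rewrite eqxx -cats1; have := mem_plan_end s (log st i ++ [:: Move v]); rewrite plan_end_cat.
  exists k; case: (ord2_or k ij) xk => -> xk; rewrite ?ji eqxx -cats1; exact: mem_plan_nodes_catl.
- move=> k; case: (ord2_or k ij) => ->; rewrite ?ji ?eqxx; first exact: reach_new.
  by apply: reach_sub (bp j); exact: finset.subsetUr.
- move=> x; rewrite in_setU1 => /orP[/eqP->|/br[d xd]].
    by eexists; exact: reach_new (bp i) ev.
  by exists d; apply: reach_sub xd; exact: finset.subsetUr.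
Qed.

Lemma base_takeover st th i j u w p q : base st th -> i != j ->
  shortest G (visited st) (pos st i) u p -> shortest G (visited st) s u q ->
  base (takeover_state st i j u w p q) (th + walk_len G (pos st i) p).
Proof.
case=> bv be bt bc bp br ij sp sq; have ji : (j == i) = false by rewrite eq_sym (negPf ij).
have [[/walk_inP[pp _ _ lp] _] [/walk_inP[pq _ _ _] _]] := (sp, sq).
have lv := walk_len_ge0 pp; split=> /=.
- move=> k; case: (ord2_or k ij) => ->; rewrite ?ji eqxx ?plan_valid_cat ?bv ?be ?plan_valid_moves //.
  by rewrite -cats1 plan_valid_cat bv /= lv.
- move=> k; case: (ord2_or k ij) => ->; rewrite ?ji eqxx ?plan_end_cat ?be ?plan_end_moves //.
  by rewrite -cats1 plan_end_cat be.
- move=> k; case: (ord2_or k ij) => ->; rewrite ?ji eqxx ?plan_time_cat ?bt ?be ?plan_time_moves //.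
  by rewrite -cats1 plan_time_cat bt /= addr0.
- move=> x /bc[k xk]; exists k.
  by case: (ord2_or k ij) xk => -> xk; rewrite ?ji eqxx -?cats1; exact: mem_plan_nodes_catl.
- move=> k; case: (ord2_or k ij) => ->; rewrite ?ji ?eqxx //; exact: reach_shortest.
- by [].
Qed.

Lemma base_together st th v (w : 'I_2 -> V) : base st th -> (forall k, edge G (pos st k) v) ->
  (forall k, len G (pos st k) v = len G (pos st ord0) v) ->
  base (together_state st v w) (th + len G (pos st ord0) v).
Proof.
case=> bv be bt bc bp br ev lv; split=> /=.
- by move=> k; rewrite -cats1 plan_valid_cat bv /= be ev.
- by move=> k; rewrite -cats1 plan_end_cat.
- by move=> k; rewrite -cats1 plan_time_cat bt /= be lv addr0.
- move=> x; rewrite in_setU1 => /orP[/eqP->|/bc[k xk]].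
    exists ord0; rewrite -cats1.
    by have := mem_plan_end s (log st ord0 ++ [:: Move v]); rewrite plan_end_cat.
  by exists k; rewrite -cats1; exact: mem_plan_nodes_catl.
- by move=> k; exact: reach_new.
- move=> x; rewrite in_setU1 => /orP[/eqP->|/br[d xd]].
    by eexists; exact: reach_new (bp ord0) (ev _).
  by exists d; apply: reach_sub xd; exact: finset.subsetUr.
Qed.

Lemma heading_goal st k v : heading st k = Some v ->
  goal st k = Some v /\ v \notin visited st.
Proof. by rewrite /heading; case: (goal st k) => // w; case: ifP => // /negbT wv [<-]. Qed.

Lemma heading_amp st i j v o : next_goal G (v |: visited st) v o ->
  heading (amp_state st i j v o) i = o.
Proof.
by rewrite /heading /= eqxx; case: o => //= w; rewrite !inE => /andP[_ /negPf->].
Qed.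

Lemma heading_amp_other st i j v o : i != j ->
  heading (amp_state st i j v o) j =
  if heading st j is Some w then if w == v then None else Some w else None.
Proof.
rewrite /heading /= eq_sym => /negPf->; case: (goal st j) => // w.
by rewrite in_setU1; case: (w \in _); case: (w == v).
Qed.

Lemma heading_takeover st i j u w p q : w \notin visited st ->
  heading (takeover_state st i j u w p q) i = Some w.
Proof. by rewrite /heading /= eqxx => /negPf->. Qed.

Lemma heading_takeover_other st i j u w p q : i != j ->
  heading (takeover_state st i j u w p q) j = heading st j.
Proof. by rewrite /heading /= eq_sym => /negPf->. Qed.

Lemma next_goal_exists D v : exists o, next_goal G D v o.
Proof.
have [f0|/set0Pn[w wf]] := eqVneq (fresh G D v) finset.set0; last by exists (Some w).
by exists None.
Qed.

Context (M : R) (M_ge0 : 0 <= M)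
  (ecc_le : forall v, exists2 d, reach G [set: V] s v d & d <= M).

Definition good (P : 'I_2 -> plan R V) :=
  exploration G s P /\ time_cost G s P <= 5%:R * M.

Lemma good_log st th : base st th -> visited st = [set: V] ->
  (forall k, pos st k = s) -> th <= 5%:R * M -> good (log st).
Proof.
case=> bv be bt bc _ _ vT ps th_le; split; first split.
- by move=> k; rewrite be ps.
- by move=> v; apply: bc; rewrite vT inE.
- by rewrite bigmax_le ?mulr_ge0 // => k _; rewrite bt.
Qed.

Lemma explored_all st th : base st th -> explored G st -> visited st = [set: V].
Proof.
move=> bs ex; apply/setP => v; rewrite inE; have sv := base_start_visited bs.
have /connectP[p sp ->] := edge_conn G s v.
elim: p s sv sp => [//|w p IH] u uv /= /andP[euw wp]; apply: IH wp.
by apply: contraT => wv; have /setP/(_ w) := ex u uv; rewrite !inE euw wv.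
Qed.

Lemma run_explored st th : base st th -> explored G st -> th <= 4%:R * M ->
  every_run G s good st.
Proof.
move=> bs ex th_le; have vT := explored_all bs ex.
have [fin|nfin] := pselect (finished G s st).
  by apply: RunFinished => //; apply: good_log bs vT (proj2 fin) _; move: M_ge0 th_le; lra.
have /fin_all_exists[p sp] : forall k, exists p, shortest G (visited st) (pos st k) s p.
  move=> k; have [d] := base_reach bs (base_pos_visited k bs).
  by move=> /reach_sym /reach_exists_shortest.
apply: RunStep => //; first by eexists; exact: StepReturn sp.
move=> st'; case=> {p sp}.
- by move=> v w _ /heading_goal[_]; rewrite vT inE.
- by move=> i j v o _ _ /heading_goal[_]; rewrite vT inE.
- by move=> i j u w p q _ _ [_]; rewrite vT !inE andbF.
move=> p _ _ sp; apply: RunFinished; first by split.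
case: bs (bs) => bv be bt bc _ _ bs; split; first split.
- move=> k /=; rewrite plan_valid_cat bv be plan_valid_moves plan_end_cat be plan_end_moves.
  by case: (sp k) => /walk_inP[-> _ _ ->] _.
- move=> v; have [|k vk] := bc v; first by rewrite vT inE.
  by exists k; exact: mem_plan_nodes_catl.
rewrite bigmax_le ?mulr_ge0 // => k _ /=; rewrite plan_time_cat bt be plan_time_moves.
have [d /reach_sym sd d_le] := ecc_le (pos st k); rewrite vT in sp.
by have := shortest_reach (sp k) sd; lra.
Qed.

Lemma run_apart st th : base st th -> ~ explored G st -> ~ together st ->
  (forall i j v o, i != j -> heading st i = Some v -> amp_turn G st i j v ->
     next_goal G (v |: visited st) v o -> every_run G s good (amp_state st i j v o)) ->
  (forall i j u w p q, i != j -> heading st i = None -> unclaimed G st j u w ->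
     shortest G (visited st) (pos st i) u p -> shortest G (visited st) s u q ->
     every_run G s good (takeover_state st i j u w p q)) ->
  every_run G s good st.
Proof.
move=> bs nex ntog amp take; apply: RunStep; first by case.
  have moves i j v : i != j -> heading st i = Some v -> amp_turn G st i j v ->
      exists st', step G s st st'.
    move=> ij hi turn; have [o ho] := next_goal_exists (v |: visited st) v.
    by eexists; exact: StepAmp ij ntog hi turn ho.
  have takes i j u w : i != j -> heading st i = None -> unclaimed G st j u w ->
      exists st', step G s st st'.
    move=> ij hi un; case: (un) => uv _ _; have [d su] := base_reach bs uv.
    have [q sq] := reach_exists_shortest su.
    have /reach_exists_shortest[p sp] := reach_trans (reach_sym (base_pos bs i)) su.
    by eexists; exact: StepTakeOver ij hi un sp sq.
  have idle i j v : i != j -> heading st i = Some v -> heading st j = None ->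
      exists st', step G s st st'.
    move=> ij hi hj; have [[u [w un]]|nun] := pselect (exists u w, unclaimed G st i u w).
      by apply: takes hj un; rewrite eq_sym.
    by apply: moves ij hi _; rewrite /amp_turn hj => u w un; apply: nun; exists u, w.
  case h0 : (heading st ord0) => [v|]; case h1 : (heading st ord_max) => [w|].
  - have [le01|/ltW le10] := lerP (trav st ord0 + len G (pos st ord0) v)
                                  (trav st ord_max + len G (pos st ord_max) w).
      by apply: (moves ord0 ord_max v) => //; rewrite /amp_turn h1.
    by apply: (moves ord_max ord0 w) => //; rewrite /amp_turn h0.
  - exact: (idle ord0 ord_max v).
  - exact: (idle ord_max ord0 w).
  - have [[u [w [uv wf]]]|nb] := pselect (exists u w, u \in visited st /\ w \in fresh G (visited st) u).
      by apply: (takes ord0 ord_max u w) => //; split=> //; rewrite h1 => -[].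
    case: nex => u uv; apply/setP => w; rewrite finset.in_set0; apply/negP => wf.
    by apply: nb; exists u, w.
move=> st' []; last by [].
- by [].
- by move=> i j v o ij _; exact: amp.
- exact: take.
Qed.

Lemma every_run_mono (Q Q' : ('I_2 -> plan R V) -> Prop) st :
  (forall P : 'I_2 -> plan R V, Q P -> Q' P) -> every_run G s Q st -> every_run G s Q' st.
Proof.
move=> QQ'; elim=> {}st; first by move=> fin /QQ'; exact: RunFinished.
by move=> nfin ex _ IH; exact: RunStep.
Qed.

Lemma every_run_exists (Q : ('I_2 -> plan R V) -> Prop) st : every_run G s Q st -> exists P : 'I_2 -> plan R V, Q P.
Proof.
by elim=> {}st; [move=> _ QP; exists (log st)|move=> _ [st' step_st'] _ /(_ st' step_st')].
Qed.

End Runs.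

(** * The phases of a run *)

Section Phases.
Context (R : realType) (V : finType) (G : wgraph R V) (s : V).
Implicit Types (st : state R V) (x y u v w a b : V) (p q r t l c : seq V).
Implicit Types (i j k : 'I_2) (P Q : plan R V).

Definition unvisited st l := forall x, (x \in visited st) = (x \notin l).

Lemma unvisited_amp st i j v o l l' : unvisited st l -> l =i v :: l' -> v \notin l' ->
  unvisited (amp_state G st i j v o) l'.
Proof.
move=> un e vl x; rewrite in_setU1 un e inE negb_or.
by case: eqVneq => // ->; rewrite vl.
Qed.

Lemma unvisited_notin st l x : unvisited st l -> x \in visited st -> x \notin l.
Proof. by move=> ->. Qed.

Lemma unclaimed_edge st l j u w : unvisited st l -> unclaimed G st j u w ->
  [/\ u \notin l, w \in l, edge G u w & pos st j = u -> heading st j <> Some w].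
Proof.
move=> un [uv wf cl]; move: wf uv; rewrite inE !un negbK => /andP[e wl] ul.
by split=> // pu hw; apply: cl.
Qed.

Lemma not_explored st l u w : unvisited st l -> u \notin l -> w \in l -> edge G u w ->
  ~ explored G st.
Proof.
move=> un ul wl e ex; have uv : u \in visited st by rewrite un.
by have /setP/(_ w) := ex u uv; rewrite !inE un wl e.
Qed.

Lemma together_pair st i j : i != j -> together st ->
  pos st i = pos st j /\ heading st i = heading st j.
Proof.
by move=> ij [ep eh _]; case: (@ord2_pair i j ord0 ord_max ij isT) => -[<- <-].
Qed.

Lemma not_together st i j : i != j -> heading st i <> heading st j -> ~ together st.
Proof. by move=> ij hij /(together_pair ij)[]. Qed.

Lemma base_trav_ge0 st th k : base G s st th -> 0 <= trav st k.
Proof. by move=> /base_pos/(_ k)[p /walk_inP[/walk_len_ge0 ? _ _ _] <-]. Qed.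

Lemma base_notin st th l k : base G s st th -> unvisited st l -> pos st k \notin l.
Proof. by move=> /base_pos_visited bs <-. Qed.

Lemma seg_walk_ge0 a r ob : seg G a r ob -> 0 <= walk_len G a r.
Proof.
elim: r a => [|w r IH] a; first by rewrite walk_len0.
move=> sr; have /len_gt0/ltW e := seg_head_edge sr.
by rewrite walk_len_cons addr_ge0 // IH; case: sr.
Qed.

Lemma seg_next_goal_open a v r ob (D : {set V}) o : seg G a (v :: r) ob -> a \in D ->
  (forall x, onext r ob = Some x -> x \notin D) -> next_goal G D v o -> o = onext r ob.
Proof.
case=> hv _ aD nD; case: o => [w|] /=.
  rewrite !inE edge_sym hv => /andP[/orP[/eqP->|/eqP//]]; by rewrite aD.
case e : (onext r ob) => [x|//] /setP/(_ x).
by rewrite !inE edge_sym hv e eqxx orbT nD.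
Qed.

Context (M : R) (M_ge0 : 0 <= M)
  (ecc_ge : forall g, g s = 0 -> potential G g -> forall v, g v <= M)
  (ecc_le : forall v, exists2 d, reach G [set: V] s v d & d <= M).

Notation run := (every_run G s (good G s M)).

Lemma dijkstra_le r (h : V -> R) (k : R) x : pot G s r h -> 0 <= k -> s \notin r -> x \in r ->
  (forall u w, u \notin r -> w \in r -> edge G u w -> k <= h u + len G u w) -> k <= M.
Proof.
move=> hh k0 sr xr bd; have [g [gs pg gr]] := truncated_potential hh k0 sr bd.
by rewrite -(gr x xr); exact: ecc_ge.
Qed.

Lemma run_done st th : base G s st th -> unvisited st [::] -> th <= 4%:R * M -> run st.
Proof.
move=> bs un; apply: run_explored => // u _; apply/setP => w.
by rewrite !inE un andbF.
Qed.

Lemma run_single t st i j th : i != j -> base G s st th -> unvisited st t -> uniq t ->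
  seg G (pos st i) t None -> heading st i = ohead t -> heading st j = None ->
  th + walk_len G (pos st i) t <= 4%:R * M -> run st.
Proof.
elim: t st th => [|w t IH] st th ij bs un ut sg hi hj th_le.
  by apply: run_done bs un _; move: th_le; rewrite walk_len0 addr0.
have eaw := seg_head_edge sg; have aN := base_notin i bs un.
apply: (run_apart bs).
- exact: not_explored un aN (mem_head _ _) eaw.
- by apply: (not_together ij); rewrite hi hj.
- move=> i' j' v o ij'; case: (ord2_pair ij ij') => -[-> ->]; last by rewrite hj.
  rewrite hi => -[<-] _ ng.
  have /andP[wt ut'] := ut.
  have eo : o = ohead t.
    apply: seg_next_goal sg _ _ _ ng => //.
      by rewrite in_setU1 un aN orbT.
    move=> x xt; rewrite in_setU1 un inE xt orbT orbF.
    by apply: contraNneq wt => <-.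
  apply: (IH _ _ ij (base_amp o bs ij eaw)) => //.
  + exact: unvisited_amp un _ wt.
  + by rewrite /= eqxx; case: sg.
  + by rewrite heading_amp // -eo.
  + by rewrite heading_amp_other // hj.
  + by move: th_le; rewrite /= eqxx walk_len_cons addrA.
- move=> i' j' u w' p q ij'; case: (ord2_pair ij ij') => -[-> ->]; first by rewrite hi.
  move=> _ /(unclaimed_edge un)[ut' wt' e' cl].
  case: (seg_edge sg wt' e') => [ut2|[eu ew]|[]//]; first by rewrite ut2 in ut'.
  by case: cl => //; rewrite hi.
Qed.

Lemma run_leftover t st th vi (om : R) : base G s st th -> unvisited st t -> uniq t ->
  seg G vi t None -> t <> [::] -> (forall k, heading st k = None) -> vi \in visited st ->
  (forall k, exists2 d, reach G (visited st) (pos st k) vi d & d <= om) ->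
  th + om + walk_len G vi t <= 4%:R * M -> run st.
Proof.
move=> bs un ut sg; case: t sg ut un => // w t sg ut un _ hd viv om_le th_le.
have vN := unvisited_notin un viv.
apply: (run_apart bs).
- exact: not_explored un vN (mem_head _ _) (seg_head_edge sg).
- by case=> _ _; rewrite hd.
- by move=> i j v o _; rewrite hd.
- move=> i j u w' p q ij hi /(unclaimed_edge un)[ut' wt' e' _] sp sq.
  case: (seg_edge sg wt' e') => [ut2|[eu [ew]]|[]//]; first by rewrite ut2 in ut'.
  subst u w'; have wv : w \notin visited st by rewrite un mem_head.
  have [d rd d_le] := om_le i.
  apply: (run_single ij (base_takeover w bs ij sp sq)) (un) ut _ _ _ _.
  + by rewrite /= eqxx.
  + by rewrite heading_takeover.
  + by rewrite heading_takeover_other.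
  + by rewrite /= eqxx; have := shortest_reach sp rd; lra.
Qed.

(* The agents [i] and [j] approach each other on the unvisited path [r], which
   is all that is left of the cycle; the tail [t], if not empty, is unvisited
   and unclaimed, but its first neighbour [vi] is known.  With [th] the elapsed
   time, [ring_cost] bounds what was spent on top of the two paths from [s]. *)
Record ring st i j th r t vi : Prop := Ring {
  ring_neq : i != j;
  ring_base : base G s st th;
  ring_unvisited : unvisited st (r ++ t);
  ring_uniq : uniq (r ++ t);
  ring_seg : seg G (pos st i) r (Some (pos st j));
  ring_tail : seg G vi t None;
  ring_vi : vi \in visited st;
  ring_headi : heading st i = ohead r;
  ring_headj : heading st j = ohead (rev r);
  ring_size : pos st i = pos st j -> size r <> 1%N;
  ring_pot : r <> [::] -> exists h, [/\ pot G s r h, h (pos st i) = trav st i &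
                                        h (pos st j) = trav st j];
  ring_le : forall k, trav st k <= M;
  ring_cost : if nilp t then (th - trav st i - trav st j <= 2%:R * M : Prop) else
      th <= trav st i + trav st j /\
      exists2 d, reach G (visited st) s vi d & d + walk_len G vi t <= M }.

Lemma ring_sym st i j th r t vi : ring st i j th r t vi -> ring st j i th (rev r) t vi.
Proof.
case=> ij bs un ut sg st' viv hi hj sz pt le co; split=> //.
- by rewrite eq_sym.
- by move=> x; rewrite un !mem_cat mem_rev.
- by rewrite (perm_uniq (_ : perm_eq _ (r ++ t))) // perm_cat2r perm_rev.
- exact: seg_rev.
- by rewrite revK.
- by rewrite size_rev => e; exact: sz.
- case: r {un ut sg hi hj sz} pt => [//|x r] [//|h [ph ha hb] _]; exists h; split=> //.
  by apply: eq_pot ph => y; rewrite mem_rev.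
- by case: ifP co => _; rewrite ?(addrC (trav st j)) //; lra.
Qed.

Lemma ring_amp st i j th v r t vi o : ring st i j th (v :: r) t vi ->
  amp_turn G st i j v -> next_goal G (v |: visited st) v o ->
  ring (amp_state G st i j v o) i j (th + len G (pos st i) v) r t vi.
Proof.
case=> ij bs un ut sg sgt viv hi hj sz pt le co turn ng.
have ji : (j == i) = false by rewrite eq_sym (negPf ij).
have eav := seg_head_edge sg; have lav := len_gt0 eav.
have /andP[vN ut'] : (v \notin r ++ t) && uniq (r ++ t) := ut.
have [vr vt] : v \notin r /\ v \notin t by move: vN; rewrite mem_cat => /norP.
have aN := base_notin i bs un; have bN := base_notin j bs un.
have sN := unvisited_notin un (base_start_visited bs).
have vs : v != s by apply: contraNneq sN => <-; rewrite mem_head.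
have bv : pos st j != v by apply: contraNneq bN => ->; rewrite mem_head.
have [//|h [ph ha hb]] := pt.
have turn' : trav st i + len G (pos st i) v <= trav st j + len G (pos st j) (last v r).
  by move: turn; rewrite /amp_turn hj ohead_rev_cons.
have i_le : trav st i + len G (pos st i) v <= M.
  apply: (dijkstra_le ph _ _ (mem_head v r)).
  - by have := base_trav_ge0 i bs; lra.
  - by apply: contra sN => sr; rewrite mem_cat sr.
  - move=> u w ur wr e; case: (seg_edge sg wr e) => [ur'|[-> [<-]]|[[<-]]].
    + by rewrite ur' in ur.
    + by rewrite ha.
    + by rewrite ohead_rev_cons => -[<-]; rewrite hb.
have eo : o = ohead r.
  apply: seg_next_goal sg _ _ _ ng => //.
  - by rewrite in_setU1 un aN orbT.
  - move=> x xr; rewrite in_setU1 un /= inE mem_cat xr !orbT orbF.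
    by apply: contraNneq vr => <-.
  - by move=> b [<-]; rewrite in_setU1 un bN orbT.
split=> //=; rewrite ?eqxx ?ji //.
- exact: base_amp.
- exact: unvisited_amp un _ vN.
- by case: sg.
- by rewrite in_setU1 viv orbT.
- by rewrite heading_amp.
- rewrite heading_amp_other // hj ohead_rev_cons.
  case: (r) vr => [|x r']; first by rewrite /= eqxx.
  rewrite ohead_rev_cons /=; case: eqVneq => // <-; by rewrite mem_last.
- by move=> e; rewrite -e eqxx in bv.
- move=> rN; exists [eta h with v |-> h (pos st i) + len G (pos st i) v].
  rewrite /= eqxx (negPf bv) ha; split=> //; rewrite -ha; apply: pot_extend => // u.
  case: sg => -> _ /orP[/eqP//|]; case: (r) rN => //= x r' _ /eqP[->].
  by rewrite mem_head.
- by move=> k; case: (ord2_or k ij) => ->; rewrite ?eqxx ?ji.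
- case: ifP co => _; first lra.
  case=> th_le [d rd d_le]; split; first lra.
  by exists d => //; apply: reach_sub rd; exact: finset.subsetUr.
Qed.

Lemma run_ring st i j th r t vi : ring st i j th r t vi -> run st.
Proof.
have [n] := ubnP (size r); elim: n => // n IH in st i j th r * => size_r rg.
have amp i1 j1 th1 r1 v o : (size r1 <= n)%N -> ring st i1 j1 th1 r1 t vi ->
    heading st i1 = Some v -> amp_turn G st i1 j1 v ->
    next_goal G (v |: visited st) v o -> run (amp_state G st i1 j1 v o).
  move=> size_r1 rg1; rewrite (ring_headi rg1).
  case: r1 size_r1 rg1 => // w r1 size_r1 rg1 [ew]; subst w => turn ng.
  by apply: IH (ring_amp rg1 turn ng).
case: (rg) => ij bs un ut sg sgt viv hi hj sz pt le co.
have [r0|/eqP rN] := eqVneq r [::].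
  subst r; have [t0|tN] := eqVneq t [::].
    by subst t; apply: (run_done bs) => //; have := le i; have := le j; move: co => /=; lra.
  move: co; case: nilP => [t0|_ [th_le [d rd d_le]]]; first by rewrite t0 in tN.
  apply: (run_leftover (om := M + d) bs un ut sgt) => //; first exact/eqP.
  - by move=> k; case: (ord2_or k ij) => ->; rewrite ?hi ?hj.
  - move=> k; exists (trav st k + d); last by rewrite lerD2r.
    exact: reach_trans (reach_sym (base_pos bs k)) rd.
  - by have := le i; have := le j; lra.
have [x [r' er]] : exists x r', r = x :: r' by case: (r) rN => // x r'; exists x, r'.
rewrite {}er {rN} in size_r rg un ut sg hi hj sz pt *.
apply: (run_apart bs).
- by apply: not_explored un (base_notin i bs un) (mem_head _ _) (seg_head_edge sg).
- move=> /(together_pair ij)[/sz]; rewrite hi hj ohead_rev_cons.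
  case: r' {size_r rg un sg hi hj sz pt} ut => //= y r' /andP[xN _] _ [ex].
  by move: xN; rewrite -cat_cons mem_cat {1}ex mem_last.
- move=> i' j' v o ij'; case: (ord2_pair ij ij') => -[-> ->]; first exact: amp rg.
  by apply: amp (ring_sym rg); rewrite size_rev.
- move=> i' j' u w p q ij'; case: (ord2_or i' ij) => ->; first by rewrite hi.
  by rewrite hj ohead_rev_cons.
Qed.

Lemma pot_reach r (h : V -> R) (D : {set V}) v d : pot G s r h ->
  (forall x, x \in D -> x \notin r) -> reach G D s v d -> h v <= d.
Proof.
move=> [hs hl] Dr [p /walk_inP[sp sD pD <-] <-].
suff: h (last s p) <= h s + walk_len G s p by rewrite hs add0r.
elim: p (s) sD sp pD => [|y p IH] x xD /=; first by rewrite walk_len0 addr0.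
case/andP=> exy yp pD; have yD : y \in D by rewrite pD ?mem_head.
have := IH y yD yp (fun w wp => pD w (mem_behead (wp : w \in behead (y :: p)))).
by have := hl x y exy (Dr _ xD) (Dr _ yD); rewrite walk_len_cons; lra.
Qed.

(* Agent [i] walks round the cycle towards the known node [vi], the unvisited
   part being [r]; agent [j] walks towards the free end of the dead end [t]
   and, when done, takes over the other end of [r]. *)
Record cross st i j th r t vi (h : V -> R) (tau : R) : Prop := Cross {
  cross_neq : i != j;
  cross_base : base G s st th;
  cross_unvisited : unvisited st (r ++ t);
  cross_uniq : uniq (r ++ t);
  cross_nonempty : r <> [::];
  cross_seg : seg G (pos st i) r (Some vi);
  cross_tail : seg G (pos st j) t None;
  cross_vi : vi \in visited st;
  cross_headi : heading st i = ohead r;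
  cross_headj : heading st j = ohead t;
  cross_size : pos st i = vi -> size r <> 1%N;
  cross_pot : pot G s r h;
  cross_poti : h (pos st i) = trav st i;
  cross_reachvi : reach G (visited st) s vi (h vi);
  cross_lei : trav st i <= M;
  cross_lej : trav st j + walk_len G (pos st j) t <= M;
  cross_levi : h vi <= M;
  cross_time : th = trav st i + trav st j;
  cross_back : reach G (visited st) (pos st j) vi tau;
  cross_cost : trav st j + tau - h vi + 2%:R * walk_len G (pos st j) t <= 2%:R * M }.

Lemma cross_amp_ring st i j th v r w t vi h tau o :
  cross st i j th (v :: r) (w :: t) vi h tau -> r <> [::] ->
  amp_turn G st i j v -> next_goal G (v |: visited st) v o ->
  cross (amp_state G st i j v o) i j (th + len G (pos st i) v) r (w :: t) vi
    [eta h with v |-> h (pos st i) + len G (pos st i) v] tau.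
Proof.
case=> ij bs un ut _ sg sgt viv hi hj sz pt ha rvi lei lej levi th_eq bk co rN turn ng.
have ji : (j == i) = false by rewrite eq_sym (negPf ij).
have eav := seg_head_edge sg; have lav := len_gt0 eav.
have /andP[vN ut'] : (v \notin r ++ w :: t) && uniq (r ++ w :: t) := ut.
have [vr vt] : v \notin r /\ v \notin w :: t by move: vN; rewrite mem_cat => /norP.
have aN := base_notin i bs un.
have viN := unvisited_notin un viv.
have sN := unvisited_notin un (base_start_visited bs).
have vs : v != s by apply: contraNneq sN => <-; rewrite mem_head.
have viv' : vi != v by apply: contraNneq viN => ->; rewrite mem_head.
have sub : visited st \subset v |: visited st := finset.subsetUr _ _.
have [_ sgt'] := sgt; have := seg_walk_ge0 sgt' => t_ge0.
have eo : o = ohead r.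
  apply: seg_next_goal sg _ _ _ ng => //.
  - by rewrite in_setU1 un aN orbT.
  - move=> x xr; rewrite in_setU1 un /= inE mem_cat xr !orbT orbF.
    by apply: contraNneq vr => <-.
  - by move=> b [<-]; rewrite in_setU1 viv orbT.
split=> //=; rewrite ?eqxx ?ji ?(negPf viv') //.
- exact: base_amp.
- exact: unvisited_amp un _ vN.
- by case: sg.
- by rewrite in_setU1 viv orbT.
- by rewrite heading_amp.
- rewrite heading_amp_other // hj /=; case: eqVneq => // ewv.
  by rewrite ewv mem_head in vt.
- by move=> e; rewrite -e eqxx in viv'.
- apply: pot_extend => // u.
  case: sg => -> _ /orP[/eqP//|]; case: (r) rN => //= x r' _ /eqP[->].
  by rewrite mem_head.
- by rewrite ha.
- exact: reach_sub rvi.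
- move: turn lej; rewrite /amp_turn hj walk_len_cons /=; lra.
- by rewrite th_eq; lra.
- exact: reach_sub bk.
Qed.

Lemma cross_amp_tail st i j th r v t vi h tau o : cross st i j th r (v :: t) vi h tau ->
  next_goal G (v |: visited st) v o ->
  cross (amp_state G st j i v o) i j (th + len G (pos st j) v) r t vi h
    (len G (pos st j) v + tau).
Proof.
case=> ij bs un ut rN sg sgt viv hi hj sz pt ha rvi lei lej levi th_eq bk co ng.
have ji : j != i by rewrite eq_sym.
have eav := seg_head_edge sgt; have lav := len_gt0 eav.
have perm : perm_eq (r ++ v :: t) (v :: r ++ t) by rewrite -cat1s perm_catCA.
have /andP[vN ut'] : (v \notin r ++ t) && uniq (r ++ t).
  by rewrite -[_ && _]/(uniq (v :: r ++ t)) -(perm_uniq perm).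
have [vr vt] : v \notin r /\ v \notin t by move: vN; rewrite mem_cat => /norP.
have bN := base_notin j bs un.
have sub : visited st \subset v |: visited st := finset.subsetUr _ _.
have [_ sgt'] := sgt; have := seg_walk_ge0 sgt' => t_ge0.
have eo : o = ohead t.
  apply: seg_next_goal sgt _ _ _ ng => //.
  - by rewrite in_setU1 un bN orbT.
  - move=> x xt; rewrite in_setU1 un mem_cat inE xt !orbT orbF.
    by apply: contraNneq vt => <-.
split=> //=; rewrite ?eqxx ?(negPf ij) //.
- exact: base_amp.
- exact: unvisited_amp un (perm_mem perm) vN.
- by rewrite in_setU1 viv orbT.
- rewrite heading_amp_other // hi; case: (r) vr => //= x r'.
  by rewrite inE negb_or eq_sym => /andP[/negPf->].
- by rewrite heading_amp.
- exact: reach_sub rvi.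
- by move: lej; rewrite walk_len_cons; lra.
- by rewrite th_eq; lra.
- apply: reach_trans (reach_sub sub bk); rewrite (len_sym eav).
  apply: reach_edge; rewrite 1?edge_sym // in_setU1 ?eqxx //.
  by rewrite (base_pos_visited j bs) orbT.
- by move: co; rewrite walk_len_cons; lra.
Qed.

Lemma run_cross st i j th r t vi h tau : cross st i j th r t vi h tau -> run st.
Proof.
have [n] := ubnP (size r + size t); elim: n => // n IH in st th r t h tau * => size_rt cr.
case: (cr) => ij bs un ut rN sg sgt viv hi hj sz pt ha rvi lei lej levi th_eq bk co.
have ji : j != i by rewrite eq_sym.
have [x [r' er]] : exists x r', r = x :: r' by case: (r) rN => // x r'; exists x, r'.
rewrite {}er {rN r} in size_rt cr un ut sg hi sz pt *.
apply: (run_apart bs).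
- by apply: not_explored un (base_notin i bs un) (mem_head _ _) (seg_head_edge sg).
- apply: (not_together ij); rewrite hi hj.
  case: t {size_rt cr un sgt hj lej co} ut => //= y t /andP[xN _] [exy].
  by rewrite exy mem_cat mem_head orbT in xN.
- move=> i' j' v o ij'; case: (ord2_pair ij ij') => -[-> ->]; last first.
    rewrite hj; case: t size_rt cr {un ut sgt hj lej co} => // y t size_rt cr [<-] _ ng.
    by apply: IH (cross_amp_tail cr ng); rewrite addnS ltnS in size_rt.
  rewrite hi => -[<-] turn ng.
  case: t size_rt cr un ut sgt hj lej co => [|y t] size_rt cr un ut sgt hj lej co.
    have e_last : edge G vi (last x r').
      by have := seg_rev sg; rewrite lastI rev_rcons => /seg_head_edge.
    move: turn; rewrite /amp_turn hj => /(_ vi (last x r')) []; split=> //.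
      by rewrite inE e_last un /= negbK cats0 mem_last.
    case=> /sz szN; rewrite hi => -[exl]; case: (r') szN exl ut => //= z r'' _ exl /andP[].
    by rewrite {1}exl cats0 mem_last.
  have [r0|/eqP r'N] := eqVneq r' [::]; last first.
    by apply: IH (cross_amp_ring cr r'N turn ng); rewrite addSn ltnS in size_rt.
  subst r'; have /andP[xN ut'] := ut.
  have eo : o = None.
    apply: seg_next_goal sg _ _ _ ng => //.
      by rewrite in_setU1 (base_pos_visited i bs) orbT.
    by move=> b [<-]; rewrite in_setU1 viv orbT.
  apply: (run_single (t := y :: t) ji (base_amp o bs ij (seg_head_edge sg))) => //.
  + exact: unvisited_amp un _ xN.
  + by rewrite /= (negPf ji).
  + rewrite heading_amp_other // hj /=; case: eqVneq => // exy.
    by rewrite exy /= mem_head in xN.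
  + by rewrite heading_amp.
  + rewrite /= (negPf ji) th_eq; move: turn lej; rewrite /amp_turn hj walk_len_cons /=.
    by case: sgt => _ /seg_walk_ge0; move: M_ge0; lra.
- move=> i' j' u w p q ij'; case: (ord2_pair ij ij') => -[-> ->]; first by rewrite hi.
  rewrite hj; case: t size_rt cr un ut sgt hj lej co => // size_rt cr un ut sgt hj lej co _.
  rewrite cats0 in un ut.
  move=> /(unclaimed_edge un)[ux wx e cl] sp sq.
  case: (seg_edge sg wx e) => [ux'|[eu ew]|[[eu] ew]]; first by rewrite ux' in ux.
    by case: cl => //; rewrite hi.
  subst u; have eh : walk_len G s q = h vi.
    apply/eqP; rewrite eq_le (shortest_reach sq rvi) (pot_reach pt _ (reach_shortest sq)) //.
    by move=> y; rewrite un.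
  suff rg : ring (takeover_state G s st j i vi w p q) i j (th + walk_len G (pos st j) p)
      (x :: r') [::] vi by exact: run_ring rg.
  have wv : w \notin visited st by rewrite un wx.
  split; rewrite /= ?(negPf ij) ?eqxx //.
  + exact: base_takeover.
  + by rewrite cats0.
  + by rewrite cats0.
  + by rewrite heading_takeover_other.
  + by rewrite heading_takeover // ew.
  + by move=> _; exists h; split.
  + by move=> k; case: (ord2_or k ij) => ->; rewrite ?eqxx ?(negPf ij) // eh.
  + rewrite eh th_eq; have := shortest_reach sp bk.
    by move: co; rewrite walk_len0; lra.
Qed.

(* Both agents walk on the cycle, and the node [vi] of degree 3 is unvisited. *)
Record arms st i j th r1 r2 vi t : Prop := Arms {
  arms_neq : i != j;
  arms_base : base G s st th;
  arms_unvisited : unvisited st (vi :: r1 ++ r2 ++ t);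
  arms_uniq : uniq (vi :: r1 ++ r2 ++ t);
  arms_segi : seg G (pos st i) r1 (Some vi);
  arms_segj : seg G (pos st j) r2 (Some vi);
  arms_tail : seg G vi t None;
  arms_nonempty : t <> [::];
  arms_vi : forall u, edge G u vi =
    [|| u == last (pos st i) r1, u == last (pos st j) r2 | Some u == ohead t];
  arms_headi : heading st i = Some (head vi r1);
  arms_headj : heading st j = Some (head vi r2);
  arms_size : pos st i = pos st j -> (0 < size (r1 ++ r2))%N;
  arms_pot : exists h, [/\ pot G s (vi :: r1 ++ r2 ++ t) h, h (pos st i) = trav st i &
                           h (pos st j) = trav st j];
  arms_le : forall k, trav st k <= M;
  arms_time : th = trav st i + trav st j }.

Lemma arms_perm vi r1 r2 t : perm_eq (vi :: r1 ++ r2 ++ t) (vi :: r2 ++ r1 ++ t).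
Proof. by rewrite perm_cons perm_catCA. Qed.

Lemma arms_sym st i j th r1 r2 vi t : arms st i j th r1 r2 vi t -> arms st j i th r2 r1 vi t.
Proof.
case=> ij bs un ut s1 s2 sgt tN nb hi hj sz [h [ph ha hb]] le th_eq.
have perm := arms_perm vi r1 r2 t; split=> //.
- by rewrite eq_sym.
- by move=> x; rewrite un (perm_mem perm).
- by rewrite -(perm_uniq perm).
- by move=> u; rewrite nb orbCA.
- by rewrite size_cat addnC -size_cat => e; exact: sz.
- by exists h; split=> //; apply: eq_pot ph; exact: perm_mem.
- by rewrite addrC.
Qed.

Lemma arms_boundary st i j th r1 r2 vi t u w : arms st i j th r1 r2 vi t ->
  u \notin vi :: r1 ++ r2 ++ t -> w \in vi :: r1 ++ r2 ++ t -> edge G u w ->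
  (u = pos st i /\ w = head vi r1) \/ (u = pos st j /\ w = head vi r2).
Proof.
case=> _ _ _ _ s1 s2 sgt _ nb _ _ _ _ _ _.
rewrite !inE !mem_cat !negb_or => /and4P[uvi ur1 ur2 ut].
case/or4P=> [/eqP->|wr|wr|wt] e.
- move: e; rewrite nb => /or3P[/eqP eu|/eqP eu|/eqP eu].
  + left; case: (r1) eu ur1 => // x r eu; rewrite eu /= mem_last.
    by [].
  + right; case: (r2) eu ur2 => // x r eu; rewrite eu /= mem_last.
    by [].
  + by rewrite (ohead_mem (esym eu)) in ut.
- case: (seg_edge s1 wr e) => [ur|[-> ew]|[[eu]]]; last by rewrite eu eqxx in uvi.
    by rewrite ur in ur1.
  by left; case: (r1) ew => //= x r [].
- case: (seg_edge s2 wr e) => [ur|[-> ew]|[[eu]]]; last by rewrite eu eqxx in uvi.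
    by rewrite ur in ur2.
  by right; case: (r2) ew => //= x r [].
- case: (seg_edge sgt wt e) => [ut'|[eu _]|[]//]; first by rewrite ut' in ut.
  by rewrite eu eqxx in uvi.
Qed.

Lemma arms_amp st i j th v r1 r2 vi t o : arms st i j th (v :: r1) r2 vi t ->
  trav st i + len G (pos st i) v <= M -> next_goal G (v |: visited st) v o ->
  arms (amp_state G st i j v o) i j (th + len G (pos st i) v) r1 r2 vi t.
Proof.
case=> ij bs un ut s1 s2 sgt tN nb hi hj sz [h [ph ha hb]] le th_eq i_le ng.
have ji : (j == i) = false by rewrite eq_sym (negPf ij).
have eav := seg_head_edge s1; have lav := len_gt0 eav.
have perm : perm_eq (vi :: (v :: r1) ++ r2 ++ t) (v :: vi :: r1 ++ r2 ++ t).
  by apply/permPl; exact: (perm_catCA [:: vi] [:: v] _).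
have := ut; rewrite (perm_uniq perm) cons_uniq => /andP[vN ut'].
have aN := base_notin i bs un; have bN := base_notin j bs un.
have sN := unvisited_notin un (base_start_visited bs).
rewrite !(perm_mem perm) in aN bN sN.
have vs : v != s by apply: contraNneq sN => <-; rewrite mem_head.
have bv : pos st j != v by apply: contraNneq bN => ->; rewrite mem_head.
have onextN x : onext r1 (Some vi) = Some x -> x \in vi :: r1 ++ r2 ++ t.
  by case: (r1) => [|y r] /= [->]; rewrite !inE eqxx ?orbT.
have eo : o = Some (head vi r1).
  rewrite (seg_next_goal_open s1 _ _ ng); first by case: (r1).
    by rewrite in_setU1 un (perm_mem perm) aN orbT.
  move=> x /onextN xN; rewrite in_setU1 un (perm_mem perm) inE xN orbT orbF.
  by apply: contraNneq vN => <-.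
split=> //=; rewrite ?eqxx ?ji //.
- exact: base_amp.
- exact: unvisited_amp un (perm_mem perm) vN.
- by case: s1.
- by rewrite heading_amp // eo.
- rewrite heading_amp_other // hj; case: eqVneq => // e; case/negP: vN; rewrite -e.
  by case: (r2) => [|y r] /=; rewrite !inE ?mem_cat ?inE eqxx ?orbT.
- by move=> e; rewrite -e eqxx in bv.
- exists [eta h with v |-> h (pos st i) + len G (pos st i) v].
  rewrite /= eqxx (negPf bv) ha; split=> //; rewrite -ha.
  apply: pot_extend => //; first by apply: eq_pot ph; exact: perm_mem.
  move=> u; case: s1 => -> _ /orP[/eqP//|/eqP/esym/onextN ->]; by [].
- by move=> k; case: (ord2_or k ij) => ->; rewrite ?eqxx ?ji.
- by rewrite th_eq; lra.
Qed.

Lemma arms_intersection st i j th r2 vi t o : arms st i j th [::] r2 vi t ->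
  trav st i + len G (pos st i) vi <= trav st j + len G (pos st j) (head vi r2) ->
  next_goal G (vi |: visited st) vi o ->
  run (amp_state G st i j vi o).
Proof.
move=> ar turn ng; case: (ar) => ij bs un ut s1 s2 sgt tN nb hi hj sz [h [ph ha hb]] le th_eq.
have ji : (j == i) = false by rewrite eq_sym (negPf ij).
have ji' : j != i by rewrite ji.
have eav : edge G (pos st i) vi by rewrite nb eqxx.
have lav := len_gt0 eav.
have aN : pos st i \notin vi :: r2 ++ t := base_notin i bs un.
have bN : pos st j \notin vi :: r2 ++ t := base_notin j bs un.
have sN : s \notin vi :: r2 ++ t := unvisited_notin un (base_start_visited bs).
have [viN ut'] : vi \notin r2 ++ t /\ uniq (r2 ++ t) by case/andP: ut.
have vs : vi != s by apply: contraNneq sN => <-; rewrite mem_head.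
have bv : pos st j != vi by apply: contraNneq bN => ->; rewrite mem_head.
have snt : s \notin t by apply: contra sN => xt; rewrite inE /= mem_cat xt !orbT.
have bnt : pos st j \notin t by apply: contra bN => xt; rewrite inE /= mem_cat xt !orbT.
have vnt : vi \notin t by apply: contra viN => xt; rewrite mem_cat xt !orbT.
have [g [gs pg gr]] : exists g, [/\ g s = 0, potential G g &
    forall w, w \in vi :: [::] ++ r2 ++ t -> g w = trav st i + len G (pos st i) vi].
  apply: truncated_potential ph _ sN _; first by have := base_trav_ge0 i bs; lra.
  move=> u w un' wn e; case: (arms_boundary ar un' wn e) => -[-> ->].
    by rewrite ha.
  by rewrite hb.
have gvi : g vi = trav st i + len G (pos st i) vi by rewrite gr ?mem_head.
have i_le : trav st i + len G (pos st i) vi <= M by rewrite -gvi ecc_ge.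
have tail_le : trav st i + len G (pos st i) vi + walk_len G vi t <= M.
  have [||g' [g's pg' eg']] := tail_potential gs pg sgt snt.
  - rewrite cons_uniq vnt /=; by move: ut'; rewrite cat_uniq => /and3P[].
  - by move=> x xt; rewrite gvi gr // inE /= mem_cat xt !orbT.
  - by rewrite -gvi -eg' ecc_ge.
have visub x : x \in vi |: visited st = (x \notin r2 ++ t).
  by rewrite in_setU1 un inE negb_or; case: eqVneq => // ->; rewrite viN.
have nb' w : w \notin vi |: visited st -> edge G vi w ->
    (r2 <> [::] /\ w = last (pos st j) r2) \/ Some w = ohead t.
  rewrite visub negbK edge_sym nb => wN /or3P[/eqP /= ew|/eqP ew|/eqP]; last by right.
    by case/negP: aN; rewrite -ew inE wN orbT.
  left; split=> // r20; case/negP: bN; move: ew wN; rewrite r20 /= => <- wN.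
  by rewrite inE wN orbT.
have [w eo wN] : exists2 w, o = Some w & w \in fresh G (vi |: visited st) vi.
  case: o ng => [w|] /=; first by exists w.
  case: (t) tN nb visub => //= y t' _ nb1 visub1 /setP/(_ y).
  by rewrite !inE -in_setU1 visub1 edge_sym nb1 /= eqxx mem_cat mem_head !orbT.
move: wN; rewrite inE => /andP[evw wN]; rewrite eo in ng *.
have bs' := base_amp (Some w) bs ij eav.
have un' : unvisited (amp_state G st i j vi (Some w)) (r2 ++ t).
  exact: unvisited_amp un _ viN.
have hi' : heading (amp_state G st i j vi (Some w)) i = Some w by rewrite heading_amp.
have hj' : heading (amp_state G st i j vi (Some w)) j = ohead r2.
  rewrite heading_amp_other // hj; case: (r2) viN => [|x r] /=; first by rewrite eqxx.
  by rewrite inE negb_or eq_sym => /andP[/negPf->].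
have segj : seg G (pos st j) r2 (Some vi) := s2.
have rvi := base_pos bs' i; rewrite /= eqxx in rvi.
have th_eq' : th + len G (pos st i) vi = trav st i + len G (pos st i) vi + trav st j.
  by rewrite th_eq; lra.
have [r20|/eqP r2N] := eqVneq r2 [::].
  subst r2; case: (nb' w wN evw) => [[]//|ew].
  apply: (run_single (t := t) ij bs') => //.
  - by rewrite /= eqxx.
  - by rewrite hi'.
  - rewrite /= eqxx th_eq'; have := le j; move: M_ge0 tail_le; lra.
have [h' ph' eh'] : exists2 h', pot G s r2 h' & {in [predC t],
    h' =1 [eta h with vi |-> h (pos st i) + len G (pos st i) vi]}.
  apply: pot_extend_tail sgt snt; apply: pot_extend => //.
    apply: eq_pot ph => x; by rewrite !inE /= !mem_cat orbC (orbC (x \in r2)) orbC.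
  move=> u; rewrite nb mem_cat => /or3P[/eqP->//|/eqP->|/eqP/esym/ohead_mem->//].
  by case: (r2) r2N => //= y r _; rewrite mem_last orbT.
have h'vi : h' vi = trav st i + len G (pos st i) vi by rewrite eh' /= ?inE //= eqxx ha.
have h'j : h' (pos st j) = trav st j by rewrite eh' /= ?inE //= (negPf bv) hb.
have vi_in : vi \in vi |: visited st by rewrite setU11.
have le' k : (if k == i then trav st i + len G (pos st i) vi else trav st k) <= M.
  by case: ifP.
case: (nb' w wN evw) => [[_ ew]|ew].
  suff rg : ring (amp_state G st i j vi (Some w)) j i (th + len G (pos st i) vi) r2 t vi.
    exact: run_ring rg.
  split=> //; rewrite /= ?eqxx ?ji //.
  - rewrite hi' ew; by case: (r2) r2N => // y r _; rewrite ohead_rev_cons.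
  - by move=> e; rewrite e eqxx in bv.
  - by exists h'.
  - case: nilP => // _; split; first by rewrite th_eq'; lra.
    by exists (trav st i + len G (pos st i) vi).
suff cr : cross (amp_state G st i j vi (Some w)) j i (th + len G (pos st i) vi) r2 t vi h' 0.
  exact: run_cross cr.
split=> //; rewrite /= ?eqxx ?ji ?h'vi //.
- by rewrite hi'.
- by move=> e; rewrite e eqxx in bv.
- by rewrite th_eq'; lra.
- exact: reach_refl.
- by have := base_trav_ge0 i bs; lra.
Qed.

Lemma run_arms st i j th r1 r2 vi t : arms st i j th r1 r2 vi t -> run st.
Proof.
have [n] := ubnP (size r1 + size r2); elim: n => // n IH in st i j th r1 r2 * => size_r ar.
have amp i1 j1 th1 r1' r2' v o : (size r1' + size r2' <= n)%N ->
    arms st i1 j1 th1 r1' r2' vi t -> heading st i1 = Some v -> amp_turn G st i1 j1 v ->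
    next_goal G (v |: visited st) v o -> run (amp_state G st i1 j1 v o).
  move=> size_r' ar'; rewrite /amp_turn (arms_headi ar') (arms_headj ar') => -[<-].
  case: r1' size_r' ar' => [|x r1'] size_r' ar' turn ng; first exact: arms_intersection ar' turn ng.
  apply: IH (arms_amp ar' _ ng) => //.
  case: (ar') => ij bs un ut s1 s2 sgt tN nb hi hj sz [h [ph ha hb]] le th_eq.
  apply: (dijkstra_le ph _ _ (mem_head _ _)).
  - by have := base_trav_ge0 i1 bs; have := len_gt0 (seg_head_edge s1); lra.
  - exact: unvisited_notin un (base_start_visited bs).
  - move=> u w un' wn e; case: (arms_boundary ar' un' wn e) => -[-> ->].
      by rewrite ha.
    by rewrite hb.
case: (ar) => ij bs un ut s1 s2 sgt tN nb hi hj sz _ le th_eq.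
apply: (run_apart bs).
- have e : edge G (pos st i) (head vi r1).
    by case: (r1) s1 nb => [|x r] /= s1 nb; [rewrite nb eqxx|case: s1 => ->; rewrite eqxx].
  apply: not_explored un (base_notin i bs un) _ e.
  by case: (r1) => [|x r] /=; rewrite !inE eqxx ?orbT.
- move=> /(together_pair ij)[/sz]; rewrite hi hj => + [].
  move: ut; case: (r1) => [|x r]; case: (r2) => [|y r'] //= /and3P[+ + _] _ e.
  + by rewrite e mem_head.
  + by rewrite e mem_head.
  + by rewrite e mem_cat mem_head !orbT.
- move=> i' j' v o ij'; case: (ord2_pair ij ij') => -[-> ->]; first exact: amp ar.
  by apply: amp (arms_sym ar); rewrite addnC.
- move=> i' j' u w p q ij'; case: (ord2_or i' ij) => ->; first by rewrite hi.
  by rewrite hj.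
Qed.

(* From [a] the unvisited path [r] leads to [vi], to which the unvisited cycle
   [vi :: c] is attached. *)
Definition lollipop a r vi c : Prop :=
  [/\ seg G a r (Some vi), seg G vi c (Some vi), (1 < size c)%N &
      forall u, edge G u vi = [|| u == last a r, u == head vi c | u == last vi c]].

Lemma lollipop_boundary a r vi c u w : lollipop a r vi c ->
  u \notin r ++ vi :: c -> w \in r ++ vi :: c -> edge G u w -> u = a /\ w = head vi r.
Proof.
case=> s1 sc szc nb; rewrite !mem_cat !inE !negb_or => /and3P[ur uvi uc].
case/or3P=> [wr|/eqP->|wc] e.
- case: (seg_edge s1 wr e) => [ur'|[-> ew]|[[eu]]]; last by rewrite eu eqxx in uvi.
    by rewrite ur' in ur.
  by case: (r) ew => //= x r' [].
- move: e; rewrite nb => /or3P[/eqP eu|/eqP eu|/eqP eu].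
  + by case: (r) eu ur => // x r' eu; rewrite eu /= mem_last.
  + by move: uc; rewrite eu; case: (c) szc => // x c' _; rewrite /= mem_head.
  + by move: uc; rewrite eu; case: (c) szc => // x c' _; rewrite /= mem_last.
- case: (seg_edge sc wc e) => [uc'|[eu _]|[[eu] _]]; first by rewrite uc' in uc.
    by rewrite eu eqxx in uvi.
  by rewrite eu eqxx in uvi.
Qed.

Lemma lollipop_head_edge a r vi c : lollipop a r vi c -> edge G a (head vi r).
Proof. by case; case: r => [|x r] /= s1 sc _ nb; [rewrite nb eqxx|case: s1 => ->; rewrite eqxx]. Qed.

Lemma head_in_lollipop r vi c : head vi r \in r ++ vi :: c.
Proof. by case: r => [|x r] /=; rewrite mem_head. Qed.

Lemma lollipop_dijkstra a r vi c (h : V -> R) : lollipop a r vi c -> pot G s (r ++ vi :: c) h ->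
  s \notin r ++ vi :: c -> 0 <= h a -> h a + len G a (head vi r) <= M.
Proof.
move=> lp ph sN ha.
have e := lollipop_head_edge lp.
apply: (dijkstra_le ph _ sN (head_in_lollipop r vi c)).
  by have := len_gt0 e; lra.
by move=> u w uN wN e'; have [-> ->] := lollipop_boundary lp uN wN e'.
Qed.

Lemma lollipop_pot a r vi c (h : V -> R) v : lollipop a r vi c ->
  pot G s (r ++ vi :: c) h -> v = head vi r -> s \notin r ++ vi :: c ->
  a \notin r ++ vi :: c ->
  pot G s (behead (r ++ vi :: c)) [eta h with v |-> h a + len G a v].
Proof.
move=> lp ph ev sN aN; have eav := lollipop_head_edge lp; rewrite -ev in eav.
have el : r ++ vi :: c = v :: behead (r ++ vi :: c) by rewrite ev; case: (r).
apply: pot_extend; rewrite -?el //.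
  by apply: contraNneq sN => <-; rewrite ev head_in_lollipop.
move=> u e ub; have vN : v \in r ++ vi :: c by rewrite ev head_in_lollipop.
have [uN|] := boolP (u \in r ++ vi :: c); last by move=> uN; case: (lollipop_boundary lp uN vN e).
move: uN; rewrite el inE (negPf ub) orbF => /eqP euv.
by rewrite euv edge_irr in e.
Qed.

Lemma lollipop_step a v r vi c : lollipop a (v :: r) vi c -> lollipop v r vi c.
Proof. by case=> [[_ s1] sc szc nb]; split. Qed.

Lemma cycle_choice vi c w : seg G vi c (Some vi) -> (1 < size c)%N ->
  w = head vi c \/ w = last vi c ->
  exists c', [/\ perm_eq c' c, seg G vi c' (Some vi), ohead c' = Some w &
    forall w', w' = head vi c \/ w' = last vi c -> w' != w -> ohead (rev c') = Some w'].
Proof.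
move=> sc; case: c sc => [//|x c] sc _ /= [->|->].
  exists (x :: c); split=> // w' [->|->]; first by rewrite eqxx.
  by rewrite ohead_rev_cons.
exists (rev (x :: c)); rewrite perm_rev revK ohead_rev_cons; split=> //; first exact: seg_rev.
by move=> w' [->|->] //; rewrite eqxx.
Qed.

Lemma lollipop_fresh a vi c (D : {set V}) w : lollipop a [::] vi c -> a \in D ->
  w \in fresh G D vi -> w = head vi c \/ w = last vi c.
Proof.
case=> _ _ _ nb aD; rewrite inE edge_sym nb /= => /andP[+ wD] => /or3P[/eqP ew|/eqP|/eqP].
- by rewrite ew aD in wD.
- by left.
- by right.
Qed.

(* Agent [i] walks along the tail towards the cycle, agent [j] towards the free
   end, by the path [t]; [j] may have arrived there ([t = [::]]). *)
Record stem st i j th r vi c t (h : V -> R) : Prop := Stem {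
  stem_neq : i != j;
  stem_base : base G s st th;
  stem_unvisited : unvisited st ((r ++ vi :: c) ++ t);
  stem_uniq : uniq ((r ++ vi :: c) ++ t);
  stem_lollipop : lollipop (pos st i) r vi c;
  stem_tail : seg G (pos st j) t None;
  stem_headi : heading st i = Some (head vi r);
  stem_headj : heading st j = ohead t;
  stem_pot : pot G s (r ++ vi :: c) h;
  stem_poti : h (pos st i) = trav st i;
  stem_lei : trav st i <= M;
  stem_lej : trav st j + walk_len G (pos st j) t <= M;
  stem_time : th = trav st i + trav st j }.

Lemma run_stem st i j th r vi c t h : stem st i j th r vi c t h -> run st.
Proof.
have [n] := ubnP (size r + size t); elim: n => // n IH in st th r t h * => size_rt sm.
case: (sm) => ij bs un ut lp sgt hi hj ph ha lei lej th_eq.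
have ji : j != i by rewrite eq_sym.
have jif : (j == i) = false by rewrite (negPf ji).
have eh := lollipop_head_edge lp; have hin := head_in_lollipop r vi c.
have aN : pos st i \notin r ++ vi :: c.
  by have := base_notin i bs un; rewrite mem_cat => /norP[].
have sN : s \notin r ++ vi :: c.
  by have := unvisited_notin un (base_start_visited bs); rewrite mem_cat => /norP[].
have dj x : x \in r ++ vi :: c -> x \notin t.
  move: ut; rewrite cat_uniq => /and3P[_ /hasPn d _] xr; apply/negP => /d /=; by rewrite xr.
have lei' : trav st i + len G (pos st i) (head vi r) <= M.
  by rewrite -ha; apply: (lollipop_dijkstra lp ph sN); rewrite ha; exact: base_trav_ge0 bs.
have lh := len_gt0 eh.
apply: (run_apart bs).
- apply: not_explored un (base_notin i bs un) _ eh; by rewrite mem_cat hin.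
- apply: (not_together ij); rewrite hi hj => /esym/ohead_mem; apply/negP; exact: dj.
- move=> i' j' v o ij'; case: (ord2_pair ij ij') => -[-> ->]; last first.
    rewrite hj; case: t size_rt sm {dj} un ut sgt hj lej => // w t size_rt sm un ut sgt hj lej.
    move=> [<-] _ ng.
    have bN := base_notin j bs un.
    have eb := seg_head_edge sgt.
    have perm : perm_eq ((r ++ vi :: c) ++ w :: t) (w :: (r ++ vi :: c) ++ t).
      by rewrite perm_catC /= perm_cons perm_catC.
    have /andP[wN ut'] : (w \notin (r ++ vi :: c) ++ t) && uniq ((r ++ vi :: c) ++ t).
      by rewrite -[_ && _]/(uniq (w :: _)) -(perm_uniq perm).
    have [wr wt] : w \notin r ++ vi :: c /\ w \notin t by move: wN; rewrite mem_cat => /norP.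
    have eo : o = ohead t.
      apply: seg_next_goal sgt _ _ _ ng => //.
        by rewrite in_setU1 un bN orbT.
      move=> x xt; rewrite in_setU1 un mem_cat inE xt !orbT orbF.
      by apply: contraNneq wt => <-.
    suff sm' : stem (amp_state G st j i w o) i j (th + len G (pos st j) w) r vi c t h.
      by apply: IH sm'; rewrite addnS ltnS in size_rt.
    split; rewrite //= ?eqxx ?(negPf ij) //.
    + exact: base_amp.
    + exact: unvisited_amp un (perm_mem perm) wN.
    + by case: sgt.
    + rewrite heading_amp_other // hi; case: eqVneq => // ew; by rewrite -ew hin in wr.
    + by rewrite heading_amp.
    + by move: lej; rewrite walk_len_cons addrA.
    + by rewrite th_eq; lra.
  rewrite hi => -[ev] _ ng; subst v.
  have ph' := lollipop_pot lp ph erefl sN aN.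
  have bs' := base_amp o bs ij eh.
  have hj' : heading (amp_state G st i j (head vi r) o) j = ohead t.
    rewrite heading_amp_other // hj; case: (t) (dj _ hin) => //= y t'.
    by rewrite inE negb_or eq_sym => /andP[/negPf->].
  case: r => [|v r] in size_rt sm un ut lp hi ph aN sN dj eh hin lei' lh ng ph' bs' hj' *; last first.
    have /andP[vN ut'] : (v \notin (r ++ vi :: c) ++ t) && uniq ((r ++ vi :: c) ++ t) := ut.
    have aD : pos st i \in v |: visited st.
      by rewrite in_setU1 (base_pos_visited i bs) orbT.
    have oN x : onext r (Some vi) = Some x -> x \in r ++ vi :: c.
      by case: (r) => [|y r'] /= [->]; rewrite mem_head.
    have eo : o = Some (head vi r).
      case: (lp) => s1 _ _ _; rewrite (seg_next_goal_open s1 aD _ ng); first by case: (r).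
      move=> x /oN xN; rewrite in_setU1 un /= inE mem_cat xN !orbT orbF.
      by apply: contraNneq vN => <-; rewrite mem_cat xN.
    apply: (IH (amp_state G st i j v o) (th + len G (pos st i) v) r t
      [eta h with v |-> h (pos st i) + len G (pos st i) v]) => //.
    split; rewrite //= ?eqxx ?jif //.
    + exact: unvisited_amp un _ vN.
    + exact: lollipop_step lp.
    + by rewrite heading_amp.
    + by rewrite ha.
    + by rewrite th_eq; lra.
  move: ng ph' bs' hj' => /= ng ph' bs' hj'.
  have /andP[vN ut'] : (vi \notin c ++ t) && uniq (c ++ t) := ut.
  have bvi : pos st j != vi.
    by have := base_notin j bs un; rewrite /= inE => /norP[].
  have aD : pos st i \in vi |: visited st by rewrite in_setU1 (base_pos_visited i bs) orbT.
  case: o ng bs' hj' => [w|]; last first.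
    case: lp => _ sc szc nb; case: (c) szc sc nb un vN => // x c' _ sc nb un vN /setP/(_ x).
    rewrite !inE edge_sym nb /= eqxx orbT /= un /= !inE eqxx orbT /= orbF => /negbFE /eqP exv.
    by rewrite exv mem_head in vN.
  move=> ng bs' hj'; have [_ sc szc0 _] := lp.
  have [c' [pc sc' hc _]] := cycle_choice sc szc0 (lollipop_fresh lp aD ng).
  have pct : perm_eq (c' ++ t) (c ++ t) by rewrite perm_cat2r.
  have rvi := base_pos bs' i; rewrite /= eqxx in rvi.
  suff cr : cross (amp_state G st i j vi (Some w)) i j (th + len G (pos st i) vi) c' t vi
      [eta h with vi |-> h (pos st i) + len G (pos st i) vi]
      (trav st j + (trav st i + len G (pos st i) vi)).
    exact: run_cross cr.
  have sz : size c' = size c := perm_size pc.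
  have szc : (1 < size c)%N by case: lp.
  split; rewrite /= ?eqxx ?jif ?ha //.
  + have un' : unvisited (amp_state G st i j vi (Some w)) (c ++ t) by exact: unvisited_amp un _ vN.
    by move=> x; rewrite un' (perm_mem pct).
  + by rewrite (perm_uniq pct).
  + by move=> c0; rewrite -sz c0 in szc.
  + by rewrite setU11.
  + by rewrite heading_amp.
  + by move=> _; rewrite sz => c1; rewrite c1 in szc.
  + by rewrite -ha; apply: eq_pot ph' => x; rewrite (perm_mem pc).
  + by rewrite th_eq; lra.
  + apply: reach_trans rvi; apply: reach_sym; apply: reach_sub (base_pos bs j).
    exact: finset.subsetUr.
  + by move: lej; lra.
- move=> i' j' u w p q ij'; case: (ord2_pair ij ij') => -[-> ->]; first by rewrite hi.
  rewrite hj; case: t {size_rt sm dj} un ut sgt hj lej => // un ut sgt hj lej _.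
  rewrite cats0 in un.
  move=> /(unclaimed_edge un)[uN wN e cl].
  by have [eu ew] := lollipop_boundary lp uN wN e; case: cl; rewrite ?hi ?ew.
Qed.

Lemma split_goals_exists (D : {set V}) v x : x \in fresh G D v -> exists w : 'I_2 -> V, split_goals G D v w.
Proof.
move=> xf; have [/card_gt1P[y [z [yf zf yz]]]|le1] := boolP (1 < #|fresh G D v|)%N.
  exists (fun k => if k == ord0 then y else z); split=> //= k; by case: ifP.
by exists (fun=> x); split=> //; rewrite (negPf le1).
Qed.

Lemma split_goals_neq (D : {set V}) v (w : 'I_2 -> V) x y i j : split_goals G D v w -> x \in fresh G D v ->
  y \in fresh G D v -> x != y -> i != j -> w i != w j.
Proof.
move=> [_ wn] xf yf xy ij; have {}wn : w ord0 != w ord_max by apply/wn/card_gt1P; exists x, y.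
by case: (@ord2_pair i j ord0 ord_max ij isT) wn => -[-> ->] //; rewrite eq_sym.
Qed.

Lemma run_together st th v x : base G s st th -> together st -> heading st ord0 = Some v ->
  edge G (pos st ord0) v -> x \in fresh G (v |: visited st) v ->
  (forall w : 'I_2 -> V, split_goals G (v |: visited st) v w -> run (together_state G st v w)) -> run st.
Proof.
move=> bs tg hv e xf rn; have nex : ~ explored G st.
  move=> /(_ _ (base_pos_visited ord0 bs))/setP/(_ v).
  by rewrite !inE e; case: (heading_goal hv) => _ ->.
have [w wf] := split_goals_exists xf.
apply: RunStep; first by case.
  by eexists; exact: StepTogether tg hv wf.
case: (tg) => _ eh hn; have hd i : heading st i = Some v.
  by case: (@ord2_or ord0 ord_max i isT) => ->; rewrite -?eh.
move=> st' []; last by [].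
- move=> v' w' _; rewrite hv => -[<-]; exact: rn.
- by [].
- by move=> i j u w' p q _; rewrite hd.
Qed.

Lemma heading_together st v (w : 'I_2 -> V) k : w k \in fresh G (v |: visited st) v ->
  heading (together_state G st v w) k = Some (w k).
Proof. by rewrite /heading /= inE => /andP[_ /negPf->]. Qed.

Lemma unvisited_together st v (w : 'I_2 -> V) l : unvisited st (v :: l) -> v \notin l ->
  unvisited (together_state G st v w) l.
Proof.
move=> un vl x; rewrite in_setU1 un inE negb_or.
by case: eqVneq => // ->; rewrite vl.
Qed.

Lemma run_joint st th r vi c (h : V -> R) a : base G s st th ->
  unvisited st (r ++ vi :: c) -> uniq (r ++ vi :: c) -> lollipop a r vi c ->
  (forall k, pos st k = a) -> (forall k, trav st k = th) ->
  (forall k, heading st k = Some (head vi r)) -> pot G s (r ++ vi :: c) h -> h a = th ->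
  run st.
Proof.
elim: r st th h a => [|v r IH] st th h a bs un ut lp ps tr hd ph ha.
all: have eav := lollipop_head_edge lp; rewrite /= in eav.
all: have lav := len_gt0 eav.
all: have aN := base_notin ord0 bs un; rewrite ps in aN.
all: have sN := unvisited_notin un (base_start_visited bs).
all: have ph' := lollipop_pot lp ph erefl sN aN; rewrite /= in ph'.
all: have tg : together st by split; rewrite ?ps ?hd.
all: have a0 : 0 <= h a by rewrite ha -(tr ord0); exact: base_trav_ge0 bs.
- have aD : a \in vi |: visited st by rewrite in_setU1 un aN orbT.
  have [_ sc szc nb] := lp.
  have /andP[vN ut'] : (vi \notin c) && uniq c := ut.
  have cf x : x = head vi c \/ x = last vi c -> x \in fresh G (vi |: visited st) vi.
    move=> hx; have xc : x \in c.
      by case: (c) szc hx => // y c' _ /= [->|->]; rewrite ?mem_head ?mem_last.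
    have xv : x != vi by apply: contraNneq vN => <-.
    rewrite !inE edge_sym nb (negPf xv) un /= inE xc orbT /=.
    by case: hx => ->; rewrite eqxx ?orbT.
  have hl : head vi c != last vi c.
    case: (c) szc ut' => [|y [|z c']] //= _ /andP[yN _].
    by apply: contraNneq yN => ->; rewrite mem_last.
  have cf1 := cf _ (or_introl erefl); have cf2 := cf _ (or_intror erefl).
  apply: (run_together bs tg (hd ord0) _ cf1); first by rewrite ps.
  move=> w wf; have wn := split_goals_neq wf cf1 cf2 hl (isT : (ord0 : 'I_2) != ord_max).
  have w_cases k := lollipop_fresh lp aD (proj1 wf k).
  have [c' [pc sc' hc hc']] := cycle_choice sc szc (w_cases ord0).
  have lvi : th + len G a vi <= M.
    by rewrite -ha; exact: (lollipop_dijkstra lp ph sN a0).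
  suff rg : ring (together_state G st vi w) ord0 ord_max (th + len G a vi) c' [::] vi.
    exact: run_ring rg.
  split; rewrite //= ?cats0 ?ps ?tr //.
  + by rewrite -(ps ord0); apply: base_together => // k; rewrite !ps.
  + by move=> x; rewrite (perm_mem pc); exact: unvisited_together.
  + by rewrite (perm_uniq pc).
  + by rewrite setU11.
  + by rewrite heading_together //; case: wf.
  + rewrite heading_together; last by case: wf.
    by rewrite (hc' (w ord_max)) // eq_sym.
  + by move=> _; rewrite (perm_size pc) => c1; rewrite c1 in szc.
  + move=> _; exists [eta h with vi |-> h a + len G a vi]; rewrite /= eqxx ha.
    by rewrite -ha; split=> //; apply: eq_pot ph' => x; rewrite (perm_mem pc).
  + by move=> k; rewrite ps tr.
  + have : 0 <= th by rewrite -ha.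
    by move: M_ge0; lra.
- have aD : a \in v |: visited st by rewrite in_setU1 un aN orbT.
  have /andP[vN ut'] : (v \notin r ++ vi :: c) && uniq (r ++ vi :: c) := ut.
  have [s1 _ _ _] := lp.
  have oN x : onext r (Some vi) = Some x -> x \notin v |: visited st.
    move=> e; have xN : x \in r ++ vi :: c by case: (r) e => [|y r'] /= [->]; rewrite mem_head.
    rewrite in_setU1 un /= inE xN orbT orbF.
    by apply: contraNneq vN => <-.
  have er : onext r (Some vi) = Some (head vi r) by case: (r).
  have hf : head vi r \in fresh G (v |: visited st) v.
    by rewrite inE oN // andbT edge_sym; case: s1 => -> _; rewrite er eqxx orbT.
  apply: (run_together bs tg (hd ord0) _ hf); first by rewrite ps.
  move=> w wf.
  have ew k : w k = head vi r.
    by have := seg_next_goal_open s1 aD oN (proj1 wf k : next_goal G _ v (Some (w k))); rewrite er => -[].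
  apply: (IH _ (th + len G a v) [eta h with v |-> h a + len G a v] v).
  + by rewrite -(ps ord0); apply: base_together => // k; rewrite !ps.
  + exact: unvisited_together un vN.
  + exact: ut'.
  + exact: lollipop_step lp.
  + by [].
  + by move=> k; rewrite /= ps tr.
  + by move=> k; rewrite heading_together ?ew.
  + exact: ph'.
  + by rewrite /= eqxx ha.
Qed.

Definition initial_state (w : 'I_2 -> V) : state R V :=
  State (fun=> s) (fun=> 0) (fun k => Some (w k)) [set s] (fun=> [::]).

Lemma mem_fresh_start x : (x \in fresh G [set s] s) = edge G s x.
Proof.
rewrite !inE andb_idr // => e; by apply: contraTneq e => ->; rewrite edge_irr.
Qed.

Lemma heading_initial (w : 'I_2 -> V) k : split_goals G [set s] s w ->
  heading (initial_state w) k = Some (w k).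
Proof. by case=> /(_ k); rewrite /heading /= !inE => /andP[_ /negPf->]. Qed.

Lemma base_initial (w : 'I_2 -> V) : base G s (initial_state w) 0.
Proof.
have ss : s \in [set s] by rewrite inE.
split=> //=; first by move=> v; rewrite inE => /eqP->; exists ord0; rewrite mem_head.
- by move=> _; exact: reach_refl.
- by move=> v; rewrite inE => /eqP->; exists 0; exact: reach_refl.
Qed.

Lemma unvisited_initial (w : 'I_2 -> V) l : uniq (s :: l) -> (forall x, x \in s :: l) ->
  unvisited (initial_state w) l.
Proof.
move=> /= /andP[sN _] cov x; rewrite /= inE; have := cov x; rewrite inE.
by case: eqVneq => [->|_ /= ->] //; rewrite sN.
Qed.

Lemma pot_initial l : (forall x, x \in s :: l) -> pot G s l (fun=> 0).
Proof.
move=> cov; split=> // x y e xl yl; have := cov x; have := cov y.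
rewrite !inE (negPf xl) (negPf yl) !orbF => /eqP ey /eqP ex.
by rewrite ex ey edge_irr in e.
Qed.

Lemma tail_le t : seg G s t None -> uniq (s :: t) -> walk_len G s t <= M.
Proof.
move=> st ut; have p0 : potential G (fun=> 0 : R).
  by move=> x y /len_gt0; rewrite add0r; exact: ltW.
have sN : s \notin t by case/andP: ut.
have [//|g [gs pg eg]] := tail_potential (erefl : (fun=> 0 : R) s = 0) p0 st sN ut.
by rewrite -[walk_len _ _ _]add0r -eg ecc_ge.
Qed.

Lemma split_two (w : 'I_2 -> V) x y : split_goals G [set s] s w -> edge G s x -> edge G s y ->
  x != y -> (forall z, edge G s z -> z = x \/ z = y) ->
  exists i j, [/\ i != j, w i = x & w j = y].
Proof.
move=> wf sx sy xy all_xy.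
have wn : w ord0 != w ord_max.
  by apply: (split_goals_neq wf) xy _; rewrite ?mem_fresh_start.
have all_w k : w k = x \/ w k = y by apply: all_xy; rewrite -mem_fresh_start; case: wf.
case: (all_w ord0) => e0; case: (all_w ord_max) => e1; rewrite e0 e1 ?eqxx // in wn.
  by exists ord0, ord_max.
by exists ord_max, ord0.
Qed.

Lemma head_rev x0 r : head x0 (rev r) = last x0 r.
Proof. by case/lastP: r => // r y; rewrite rev_rcons last_rcons. Qed.

Lemma last_rev x0 r : last x0 (rev r) = head x0 r.
Proof. by case: r => // y r; rewrite rev_cons last_rcons. Qed.

Lemma run_start_intersection c t (w : 'I_2 -> V) : (1 < size c)%N -> t <> [::] -> uniq (s :: c ++ t) ->
  (forall x, x \in s :: c ++ t) -> seg G s c (Some s) -> seg G s t None ->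
  (forall u, edge G u s = [|| u == head s c, u == last s c | Some u == ohead t]) ->
  split_goals G [set s] s w -> run (initial_state w).
Proof.
move=> szc tN ut cov sc st nb wf.
have bs := base_initial w; have un := unvisited_initial w ut cov.
have /andP[sN uct] : (s \notin c ++ t) && uniq (c ++ t) := ut.
have [snc snt] : s \notin c /\ s \notin t by move: sN; rewrite mem_cat => /norP.
have tl : walk_len G s t <= M.
  by apply: tail_le => //=; rewrite snt; move: uct; rewrite cat_uniq => /and3P[].
have [h ph eh] : exists2 h, pot G s c h & {in [predC t], h =1 (fun=> 0)}.
  apply: pot_extend_tail st snt; apply: pot_initial => x.
  by have := cov x; rewrite !inE !mem_cat (orbC (x \in t)).
have hs : h s = 0 by rewrite eh.
have [hc lc] : head s c \in c /\ last s c \in c.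
  by case: (c) szc => // x c' _; rewrite /= mem_head mem_last.
have hl : head s c != last s c.
  move: uct; case: (c) szc => [|y [|z c']] //= _ /andP[yN _].
  by apply: contraNneq yN => ->; rewrite -cat_cons mem_cat mem_last.
have wn i j : i != j -> w i != w j.
  by apply: split_goals_neq wf _ _ hl; rewrite mem_fresh_start edge_sym nb eqxx ?orbT.
have dj x : x \in c -> x \notin t.
  by move: uct; rewrite cat_uniq => /and3P[_ /hasPn d _] xc; apply/negP => /d /negP.
have wcase k : (w k = head s c \/ w k = last s c) \/ Some (w k) = ohead t.
  have := proj1 wf k; rewrite mem_fresh_start edge_sym nb => /or3P[/eqP|/eqP|/eqP] ->;
  by [left; left|left; right|right].
have ss : s \in [set s] by rewrite inE.
have rss : reach G [set s] s s 0 by exact: reach_refl.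
have tail_run i j : i != j -> Some (w i) = ohead t -> run (initial_state w).
  move=> ij wi; have ji : j != i by rewrite eq_sym.
  case: (wcase j) => [wj|wj]; last by have := wn i j ij; rewrite -wj in wi; case: wi => ->; rewrite eqxx.
  have [c' [pc sc' ec' _]] := cycle_choice sc szc wj.
  have pct : perm_eq (c' ++ t) (c ++ t) by rewrite perm_cat2r.
  suff cr : cross (initial_state w) j i 0 c' t s h 0 by exact: run_cross cr.
  split; rewrite /= ?hs ?addr0 ?add0r ?subr0 //.
  - by move=> x; rewrite un (perm_mem pct).
  - by rewrite (perm_uniq pct).
  - by move=> c0; move: szc; rewrite -(perm_size pc) c0.
  - by rewrite heading_initial.
  - by rewrite heading_initial.
  - by move=> _ c1; move: szc; rewrite -(perm_size pc) c1.
  - by apply: eq_pot ph => x; rewrite (perm_mem pc).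
  - by lra.
case: (wcase ord0) (wcase ord_max) => [w0|w0]; last by move=> _; exact: (tail_run ord0 ord_max).
case=> [w1|w1]; last exact: (tail_run ord_max ord0).
have [c' [pc sc' ec' el']] := cycle_choice sc szc w0.
have pct : perm_eq (c' ++ t) (c ++ t) by rewrite perm_cat2r.
suff rg : ring (initial_state w) ord0 ord_max 0 c' t s by exact: run_ring rg.
split; rewrite //=.
- by move=> x; rewrite un (perm_mem pct).
- by rewrite (perm_uniq pct).
- by rewrite heading_initial.
- by rewrite heading_initial // (el' (w ord_max)) // wn.
- by move=> _ c1; move: szc; rewrite -(perm_size pc) c1.
- move=> _; exists h; split=> //; apply: eq_pot ph => x; by rewrite (perm_mem pc).
- by case: nilP => // _; split; [rewrite addr0|exists 0; rewrite ?add0r].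
Qed.

Lemma head_neq x0 r1 r2 : uniq (x0 :: r1 ++ r2) -> (0 < size (r1 ++ r2))%N ->
  head x0 r1 != head x0 r2.
Proof.
case: r1 r2 => [|x r1] [|y r2] //= /and3P[x0N xN _] _.
- by apply: contraNneq x0N => ->; rewrite mem_head.
- by apply: contraNneq x0N => <-; rewrite mem_head.
- by apply: contraNneq xN => ->; rewrite mem_cat mem_head orbT.
Qed.

Lemma run_start_cycle vi c1 c2 t (w : 'I_2 -> V) : (1 < size (c1 ++ s :: c2))%N -> t <> [::] ->
  uniq (vi :: (c1 ++ s :: c2) ++ t) -> (forall x, x \in vi :: (c1 ++ s :: c2) ++ t) ->
  seg G vi (c1 ++ s :: c2) (Some vi) -> seg G vi t None ->
  (forall u, edge G u vi = [|| u == head vi (c1 ++ s :: c2), u == last vi (c1 ++ s :: c2)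
                             | Some u == ohead t]) ->
  split_goals G [set s] s w -> run (initial_state w).
Proof.
move=> szc tN ut cov /seg_cat[sc1 [es sc2]] st nb wf.
pose l := vi :: rev c1 ++ c2 ++ t.
have perm : perm_eq (vi :: (c1 ++ s :: c2) ++ t) (s :: l).
  by apply/permP => f; rewrite /= ?count_cat /= ?count_cat /= ?count_rev; lia.
have {}ut : uniq (s :: l) by rewrite -(perm_uniq perm).
have {}cov x : x \in s :: l by rewrite -(perm_mem perm).
have bs := base_initial w; have un := unvisited_initial w ut cov.
have sr1 := seg_rev sc1.
have e1 : edge G s (head vi (rev c1)) by rewrite edge_sym es head_rev eqxx.
have e2 : edge G s (head vi c2).
  by rewrite edge_sym es; case: (c2) => [|x c'] /=; rewrite eqxx orbT.
have hs : (0 < size (rev c1 ++ c2))%N.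
  by move: szc; rewrite !size_cat size_rev /= addnS ltnS.
have [_ uvi] : s \notin l /\ uniq l by case/andP: ut.
have ne : head vi (rev c1) != head vi c2.
  by apply: head_neq hs; move: uvi; rewrite /l catA -cat_cons cat_uniq => /andP[].
have [z|i [j [ij wi wj]]] := split_two wf e1 e2 ne.
  rewrite edge_sym es => /orP[/eqP->|/eqP ez]; first by left; rewrite head_rev.
  by right; case: (c2) ez => [|x c'] /= [->].
suff ar : arms (initial_state w) i j 0 (rev c1) c2 vi t by exact: run_arms ar.
split=> //=.
- by move=> u; rewrite nb last_cat /= last_rev; case: (c1).
- by rewrite heading_initial ?wi.
- by rewrite heading_initial ?wj.
- by exists (fun=> 0); split=> //; exact: pot_initial.
- by rewrite addr0.
Qed.

Lemma run_start_tail vi c t1 t2 (w : 'I_2 -> V) : (1 < size c)%N ->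
  uniq (vi :: c ++ t1 ++ s :: t2) -> (forall x, x \in vi :: c ++ t1 ++ s :: t2) ->
  seg G vi c (Some vi) -> seg G vi (t1 ++ s :: t2) None ->
  (forall u, edge G u vi = [|| u == head vi c, u == last vi c
                             | Some u == ohead (t1 ++ s :: t2)]) ->
  split_goals G [set s] s w -> run (initial_state w).
Proof.
move=> szc ut cov sc /seg_cat[st1 [es st2]] nb wf.
pose l := (rev t1 ++ vi :: c) ++ t2.
have perm : perm_eq (vi :: c ++ t1 ++ s :: t2) (s :: l).
  by apply/permP => f; rewrite /= ?count_cat /= ?count_cat /= ?count_rev; lia.
have {}ut : uniq (s :: l) by rewrite -(perm_uniq perm).
have {}cov x : x \in s :: l by rewrite -(perm_mem perm).
have bs := base_initial w; have un := unvisited_initial w ut cov.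
have [sN ul] : s \notin l /\ uniq l by case/andP: ut.
have lp : lollipop s (rev t1) vi c.
  split=> //; first exact: seg_rev.
  by move=> u; rewrite nb last_rev orbA orbC; case: (t1).
have e1 := lollipop_head_edge lp; have hin := head_in_lollipop (rev t1) vi c.
have [r0|/eqP t2N] := eqVneq t2 [::].
  subst t2; rewrite /l cats0 in un ul cov.
  have wk k : w k = head vi (rev t1).
    have := proj1 wf k; rewrite mem_fresh_start edge_sym es /= orbF => /eqP->.
    by rewrite head_rev.
  apply: (run_joint (h := fun=> 0) (a := s) (th := 0) bs un) => //.
    by move=> k; rewrite heading_initial ?wk.
  exact: pot_initial.
have [y [t' et]] : exists y t', t2 = y :: t' by case: (t2) t2N => // y t'; exists y, t'.
have e2 : edge G s y by rewrite edge_sym es et /= eqxx orbT.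
have ne : head vi (rev t1) != y.
  move: ul; rewrite /l cat_uniq et => /and3P[_ /hasPn/(_ y (mem_head _ _)) /= yN _].
  by apply: contraNneq yN => <-.
have [z|i [j [ij wi wj]]] := split_two wf e1 e2 ne.
  rewrite edge_sym es et /= => /orP[/eqP->|/eqP[->]]; first by left; rewrite head_rev.
  by right.
have [h ph eh] : exists2 h, pot G s (rev t1 ++ vi :: c) h & {in [predC t2], h =1 (fun=> 0)}.
  apply: pot_extend_tail st2 _; last by move: sN; rewrite mem_cat => /norP[].
  by apply: pot_initial => x; rewrite in_cons mem_cat [X in _ || X]orbC -mem_cat -in_cons; exact: cov.
suff sm : stem (initial_state w) i j 0 (rev t1) vi c t2 h by exact: run_stem sm.
split=> //=.
- by rewrite heading_initial ?wi.
- by rewrite heading_initial // wj et.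
- by rewrite eh // inE /=; move: sN; rewrite mem_cat => /norP[].
- rewrite add0r; apply: tail_le => //=; move: sN ul; rewrite mem_cat cat_uniq => /norP[_ ->].
  by case/and3P.
- by rewrite addr0.
Qed.

Lemma run_start (w : 'I_2 -> V) : tadpole G -> split_goals G [set s] s w -> run (initial_state w).
Proof.
case/tadpole_segments=> vi [c [t [[szc tN] ut cov [sc st] nb]]] wf.
have := cov s; rewrite inE mem_cat => /or3P[/eqP es|/splitPr sc'|/splitPr st'].
- by subst vi; exact: run_start_intersection szc tN ut cov sc st nb wf.
- by case: sc' => c1 c2 in szc ut cov sc nb *; exact: run_start_cycle szc tN ut cov sc st nb wf.
- by case: st' => t1 t2 in tN ut cov st nb *; exact: run_start_tail szc ut cov sc st nb wf.
Qed.

End Phases.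

Lemma tadpole_edge (R : realType) (V : finType) (G : wgraph R V) (s : V) :
  tadpole G -> exists x, edge G s x.
Proof.
case/tadpole_segments=> vi [c [t [[szc _] ut _ _ _]]].
have [y ys] : exists y, y != s.
  have [<-|] := eqVneq vi s; last by exists vi.
  exists (head vi c); move: ut; case: (c) szc => // x c' _ /= /andP[].
  by rewrite inE negb_or eq_sym => /andP[].
have /connectP[[|x p] /=] := edge_conn G s y; first by move=> _ e; rewrite e eqxx in ys.
by case/andP=> sx _ _; exists x.
Qed.

Theorem theorem7 (R : realType) (V : finType) (G : wgraph R V) (s : V)
    (hG : tadpole G) :
  amp_guarantees G s (fun P : 'I_2 -> plan R V =>
    [/\ exploration G s P,
        time_cost G s P <= 5%:R / 2%:R * opt_time G s 2 &
        energy_cost G s P <= 5%:R / 2%:R * opt_energy G s 2]).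
Proof.
have [M [M0 ecc_ge ecc_le ecc_opt]] := eccentricity G s.
have [x sx] := tadpole_edge s hG.
have [w wf] : exists w : 'I_2 -> V, split_goals G [set s] s w.
  by apply: (@split_goals_exists _ _ _ _ _ x); rewrite mem_fresh_start.
have good_run v : split_goals G [set s] s v -> every_run G s (good G s M) (initial_state R s v).
  exact: run_start M0 ecc_ge ecc_le v hG.
have [P0 [ex0 _]] := every_run_exists (good_run w wf).
have energy_le_time (P : 'I_2 -> plan R V) : exploration G s P -> energy_cost G s P <= time_cost G s P.
  by case=> vP _; apply: le_bigmax2 => k _; apply: plan_dist_le_time; case: (vP k).
have opt_e : 2 * M <= opt_energy G s 2.
  apply: lb_le_inf; first by exists (energy_cost G s P0), P0.
  by move=> _ [P exP ->]; exact: ecc_opt.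
have opt_t : 2 * M <= opt_time G s 2.
  apply: lb_le_inf; first by exists (time_cost G s P0), P0.
  by move=> _ [P exP ->]; exact: le_trans (ecc_opt P exP) (energy_le_time P exP).
split; first by eexists; exact: Initial wf.
move=> _ [v vf]; apply: every_run_mono (good_run v vf) => P [exP costP].
by split=> //; have := energy_le_time P exP; lra.
Qed.
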